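(* Let $R \subset \mathbb{R}$ be a GCD-domain, totally ordered by the usual order of $\mathbb{R}$, and let $n \geq 2$ be an integer. Let $(M_n(R), P)$ be an $l$-algebra over $R$ (that is, the matrix algebra $M_n(R)$ equipped with a lattice order making it a lattice-ordered $R$-algebra, with positive cone $P$) such that the identity matrix $I$ belongs to $P$. Then $(M_n(R), P) \cong (M_n(R), M_n(R^{+}))$ as $l$-algebras over $R$.
   Context: A GCD-domain is an integral domain (commutative, with $1$) in which any two non-zero elements have a greatest common divisor; here $R$ is a subring of $\mathbb{R}$. $R^{+} = \{r \in R : r \geq 0\}$. $M_n(R)$ is the ring of $n \times n$ matrices over $R$, and $M_n(R^{+})$ is the set of matrices with all entries in $R^{+}$. An $l$-algebra $(M_n(R), P)$ over $R$ is the $R$-algebra $M_n(R)$ with a subset $P$ (the positive cone) such that $P + P \subseteq P$, $P \cdot P \subseteq P$, $R^{+} P \subseteq P$, $P \cap (-P) = \{0\}$, and such that the partial order defined by $x \leq y \iff y - x \in P$ is a lattice order on $M_n(R)$. The pair $(M_n(R), M_n(R^{+}))$ is the $l$-algebra with the usual (entrywise) lattice order. An isomorphism of $l$-algebras $(M_n(R), P) \cong (M_n(R), P')$ is an $R$-algebra isomorphism $\psi: M_n(R) \to M_n(R)$ with $\psi(P) = P'$. *)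

(* Defs.v *)
From HB Require Import structures.
From mathcomp Require Import all_boot all_order all_algebra.
From mathcomp Require Import classical_sets reals.

Set Implicit Arguments.
Unset Strict Implicit.
Unset Printing Implicit Defensive.

Import Order.TTheory GRing.Theory Num.Theory.

Local Open Scope classical_set_scope.
Local Open Scope ring_scope.

Definition divides (R : comNzRingType) (a b : R) : Prop :=
  exists c : R, b = c * a.

Definition is_gcd (R : comNzRingType) (a b d : R) : Prop :=
  [/\ divides d a, divides d b
    & forall c : R, divides c a -> divides c b -> divides c d].

(* MathComp's [idomainType] also carries a choice of inverses, so being a domain
   is stated here as a property of a plain nontrivial commutative ring. *)
Definition GCD_domain (R : comNzRingType) : Prop :=
  (forall a b : R, a * b = 0 -> a = 0 \/ b = 0) /\
  (forall a b : R, a != 0 -> b != 0 -> exists d : R, is_gcd a b d).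

(* A subring of the reals is given by [S : pred K] together with a ring
   [R : GRing.SubComNzRing.type S], whose [val : R -> K] is an injective ring
   morphism with image [S]. The order of [R] is the one of [K], read through [val]. *)
Definition nonneg (K : realType) (S : pred K) (R : GRing.SubComNzRing.type S) :
  set R := [set r | 0 <= (val r : K)].
Arguments nonneg {K S} R.

Definition nonneg_mx (K : realType) (S : pred K) (R : GRing.SubComNzRing.type S)
  (n : nat) : set 'M[R]_n := [set A | forall i j, nonneg R (A i j)].
Arguments nonneg_mx {K S} R n.

Definition cone_le (V : zmodType) (P : set V) (x y : V) : Prop := P (y - x).

Definition is_sup (T : Type) (le : T -> T -> Prop) (x y z : T) : Prop :=
  [/\ le x z, le y z & forall w : T, le x w -> le y w -> le z w].

Definition is_inf (T : Type) (le : T -> T -> Prop) (x y z : T) : Prop :=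
  [/\ le z x, le z y & forall w : T, le w x -> le w y -> le w z].

Definition partial_order (T : Type) (le : T -> T -> Prop) : Prop :=
  [/\ forall x, le x x,
      forall x y, le x y -> le y x -> x = y
    & forall x y z, le x y -> le y z -> le x z].

Definition lattice_order (T : Type) (le : T -> T -> Prop) : Prop :=
  [/\ partial_order le,
      forall x y, exists z, is_sup le x y z
    & forall x y, exists z, is_inf le x y z].

Record l_algebra (K : realType) (S : pred K) (R : GRing.SubComNzRing.type S)
    (n : nat) (P : set 'M[R]_n) : Prop := {
  l_algebra_add : forall A B, P A -> P B -> P (A + B);
  l_algebra_mul : forall A B, P A -> P B -> P (A *m B);
  l_algebra_scale : forall (r : R) A, nonneg R r -> P A -> P (r *: A);
  l_algebra_pointed : P `&` [set A | P (- A)] = [set 0];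
  l_algebra_lattice : lattice_order (cone_le P)
}.

(* MathComp gives ['M[R]_n] an algebra structure, hence [{lrmorphism _ -> _}],
   only when [n] is a successor; for a variable [n] linearity and unital
   multiplicativity are asked separately. *)
Definition l_algebra_iso (R : comNzRingType) (n : nat)
    (P Q : set 'M[R]_n) : Prop :=
  exists psi : 'M[R]_n -> 'M[R]_n,
    [/\ linear psi, monoid_morphism psi, bijective psi & psi @` P = Q].

(* Main.v *)
Require Import Defs.
From HB Require Import structures.
From mathcomp Require Import all_boot all_order all_algebra.
From mathcomp Require Import boolp classical_sets reals.

Set Implicit Arguments.
Unset Strict Implicit.
Unset Printing Implicit Defensive.

Import Order.TTheory GRing.Theory Num.Theory.

Local Open Scope ring_scope.

(** Write [v] for the embedding of [R] in the reals, and order the matrices by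
    the cone [P]. The idea is to find a real matrix [Q] that conjugates [P] into
    the nonnegative real matrices, then idempotents [f i] of [P] which [Q]
    conjugates to the diagonal matrix units, and finally to descend from the
    reals to [R] by factoring the [f i], which have rank one, over the GCD
    domain.

    The real form. Since [M_n(R)] has finite rank there is a minimal nonzero
    convex left ideal [I] ([minimal_left_ideal_exists]). Its infinitesimal
    elements form a left ideal other than [I], so [I] is archimedean. By finite
    rank again it has a finite frame, that is a maximal family of disjoint elements [t i], each of
    which lies in a totally ordered summand of [I], and it acquires real
    coordinates in which every positive functional is a combination of the
    coordinates of the frame ([positive_functional_coord]). The left action of
    [P] on [I] becomes an action by nonnegative real matrices, and by minimality
    some element of [P] acts by a matrix [S] with all entries positive
    ([act_positive]). The Perron eigenspace of [S] is a line, which everything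
    that commutes with the action must preserve ([perron_commutant]). A
    representation of the matrix ring is a multiple of the standard one, and the
    common eigenvector of its commutant forces the multiplicity to be one
    ([rep_conjugation]): the action on [I] is conjugation by some [Q] followed by
    the standard action. Right multiplications by elements of [I] commute with the
    action as well, hence are scalar, which means that [Q] conjugates [t i] to a
    matrix living in its [i]-th row ([real_form]).

    The idempotents. Nonzero columns of the [t i] form a matrix with nonzero
    determinant, so a positive multiple of the identity is a combination of
    right multiples of the [t i]. As the identity is positive, Riesz
    decomposition cuts it into [f i] in [P] which are conjugated to the matrix
    units [delta_mx i i] ([positive_idempotents]).

    The descent. Over a GCD domain, [f i = a i *m b i] for a column [a i] and a
    row [b i] over [R] ([rank_one_factorization]), and the columns [a i] form an
    invertible matrix over [R], whose inverse has the rows [b i]. After a choice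
    of signs, [a i *m b j] is conjugated to a positive multiple of
    [delta_mx i j]; it is itself positive, because its positive and negative
    parts are disjoint multiples of it ([corner_positive]). Hence [P] consists of
    the nonnegative combinations of the [a i *m b j]. *)

(** * Lattice-ordered groups through their positive cones *)

Definition disjoint_in (V : zmodType) (P : set V) (x y : V) : Prop :=
  forall e, P e -> cone_le P e x -> cone_le P e y -> e = 0.

(** Riesz decomposition and the splitting into disjoint parts stand for the
    lattice operations. *)
Record lgroup_cone (V : zmodType) (P : set V) : Prop := LGroupCone {
  cone0 : P 0;
  coneD : forall x y, P x -> P y -> P (x + y);
  cone_pointed : forall x, P x -> P (- x) -> x = 0;
  cone_riesz : forall x y z, P x -> P y -> P z -> cone_le P x (y + z) ->
    exists a b, [/\ P a, P b, x = a + b, cone_le P a y & cone_le P b z];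
  cone_split : forall x, exists p q, [/\ P p, P q, x = p - q & disjoint_in P p q]
}.

(** With [w] the infimum of [x] and [y], the pieces [w] and [x - w] witness
    Riesz decomposition; with [w] the infimum of [x] and [0], the parts [x - w]
    and [- w] of [x] are disjoint. *)
Lemma lattice_lgroup_cone (V : zmodType) (P : set V) :
  (forall x y, P x -> P y -> P (x + y)) ->
  (P `&` [set x | P (- x)])%classic = [set 0]%classic ->
  lattice_order (cone_le P) -> lgroup_cone P.
Proof.
move=> PD Pp [_ _ inf].
have P0 : P 0 by have : [set 0]%classic (0 : V) by []; rewrite -Pp => -[].
have le0 x : P x -> cone_le P 0 x by rewrite /cone_le subr0.
split=> // [x Px PNx|x y z Px Py Pz le|x].
- have : (P `&` [set x | P (- x)])%classic x by split.
  by rewrite Pp.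
- have [w [wx wy wmax]] := inf x y.
  have Pw : P w by have := wmax 0 (le0 _ Px) (le0 _ Py); rewrite /cone_le subr0.
  exists w, (x - w); split=> //; first by rewrite addrC subrK.
  have h1 : cone_le P (x - z) x by rewrite /cone_le opprB addrC subrK.
  have h2 : cone_le P (x - z) y by rewrite /cone_le opprB addrA.
  by have := wmax _ h1 h2; rewrite /cone_le !opprB addrCA.
- have [w [wx w0 wmax]] := inf x 0.
  exists (x - w), (- w); split=> //; first by move: w0; rewrite /cone_le sub0r.
    by rewrite opprK subrK.
  move=> e Pe ex e0.
  have h1 : cone_le P (w + e) x by rewrite /cone_le opprD addrA.
  have h2 : cone_le P (w + e) 0 by rewrite /cone_le sub0r opprD.
  have := wmax _ h1 h2; rewrite /cone_le opprD addrA subrr sub0r => PNe.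
  have : (P `&` [set y | P (- y)])%classic e by split.
  by rewrite Pp.
Qed.

Section LGroup.
Variables (V : zmodType) (P : set V) (cP : lgroup_cone P).
Local Notation "x '⊑' y" := (cone_le P x y) (at level 70).
Local Notation disj := (disjoint_in P).

Lemma cle_refl x : x ⊑ x.
Proof. by rewrite /cone_le subrr; apply: cone0. Qed.

Lemma cle0 x : P x -> 0 ⊑ x.
Proof. by rewrite /cone_le subr0. Qed.

Lemma cle_trans y x z : x ⊑ y -> y ⊑ z -> x ⊑ z.
Proof.
by move=> xy yz; have := coneD cP yz xy; rewrite addrA subrK.
Qed.

Lemma cle_anti x y : x ⊑ y -> y ⊑ x -> x = y.
Proof.
move=> xy yx; apply/eqP; rewrite -subr_eq0; apply/eqP.
by apply: (cone_pointed cP) => //; rewrite opprB.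
Qed.

Lemma cle_le0 x : P x -> x ⊑ 0 -> x = 0.
Proof. by move=> Px x0; apply: cle_anti => //; apply: cle0. Qed.

Lemma cleD x y x' y' : x ⊑ x' -> y ⊑ y' -> x + y ⊑ x' + y'.
Proof.
by move=> h1 h2; have := coneD cP h1 h2; rewrite addrACA -opprD.
Qed.

Lemma cle_addr x y : P y -> x ⊑ x + y.
Proof. by move=> Py; rewrite /cone_le addrAC subrr add0r. Qed.

Lemma cle_addl x y : P y -> x ⊑ y + x.
Proof. by move=> Py; rewrite addrC; apply: cle_addr. Qed.

Lemma cle_subl x y : P y -> x - y ⊑ x.
Proof. by move=> Py; rewrite /cone_le opprB addrC subrK. Qed.

Lemma coneMn x k : P x -> P (x *+ k).
Proof.
move=> Px; elim: k => [|k IH]; first by rewrite mulr0n; apply: cone0.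
by rewrite mulrS; apply: coneD.
Qed.

Lemma cone_sum (I : finType) (C : pred I) (F : I -> V) :
  (forall i, C i -> P (F i)) -> P (\sum_(i | C i) F i).
Proof. by move=> h; elim/big_rec: _ => [|i x /h Pi Px]; [apply: cone0|apply: coneD]. Qed.

Lemma cleMn x y k : x ⊑ y -> x *+ k ⊑ y *+ k.
Proof. by move=> h; have := coneMn k h; rewrite mulrnBl. Qed.

Lemma cleMnr x k l : P x -> (k <= l)%N -> x *+ k ⊑ x *+ l.
Proof. by move=> Px kl; rewrite /cone_le -mulrnBr //; apply: coneMn. Qed.

Lemma cle_sum (I : finType) (C : pred I) (F G : I -> V) :
  (forall i, C i -> F i ⊑ G i) -> \sum_(i | C i) F i ⊑ \sum_(i | C i) G i.
Proof.
by move=> h; elim/big_rec2: _ => [|i x y /h hi hy]; [apply: cle_refl|apply: cleD].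
Qed.

Lemma cle_bigD (I : finType) (F : I -> V) i :
  (forall j, P (F j)) -> F i ⊑ \sum_j F j.
Proof.
move=> h; rewrite (bigD1 i) //=; apply: cle_addr.
by apply: cone_sum => j _.
Qed.

Lemma disjC x y : disj x y -> disj y x.
Proof. by move=> d e Pe ex ey; apply: d. Qed.

Lemma disj_le x y x' : disj x y -> x' ⊑ x -> disj x' y.
Proof. by move=> d h e Pe ex ey; apply: d => //; apply: cle_trans h. Qed.

Lemma disjD x y z : P y -> P z -> disj x y -> disj x z -> disj x (y + z).
Proof.
move=> Py Pz dy dz e Pe ex /(cone_riesz cP Pe Py Pz)[a [b [Pa Pb eab ay bz]]].
have ae : a ⊑ x by apply: cle_trans ex; rewrite eab; apply: cle_addr.
have be : b ⊑ x by apply: cle_trans ex; rewrite eab; apply: cle_addl.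
by rewrite eab (dy a) // (dz b) // addr0.
Qed.

Lemma disj0 x : disj x 0.
Proof. by move=> e Pe _; apply: cle_le0. Qed.

Lemma disjMn x y k : P y -> disj x y -> disj x (y *+ k).
Proof.
move=> Py d; elim: k => [|k IH]; first by rewrite mulr0n; apply: disj0.
by rewrite mulrS; apply: disjD => //; apply: coneMn.
Qed.

Lemma disj_sum (I : finType) (C : pred I) (F : I -> V) x :
  (forall i, C i -> P (F i)) -> (forall i, C i -> disj x (F i)) ->
  disj x (\sum_(i | C i) F i).
Proof.
move=> PF d; suff [] : P (\sum_(i | C i) F i) /\ disj x (\sum_(i | C i) F i) by [].
elim/big_rec: _ => [|i y Ci [Py dy]]; first by split; [apply: cone0|apply: disj0].
by split; [apply: coneD => //; apply: PF|apply: disjD => //; [apply: PF|apply: d]].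
Qed.

Lemma disj_self x : P x -> disj x x -> x = 0.
Proof. by move=> Px d; apply: d => //; apply: cle_refl. Qed.

Lemma disj_le_cancel x y z : P x -> P y -> P z -> x ⊑ y + z -> disj x z -> x ⊑ y.
Proof.
move=> Px Py Pz h d; have [a [b [Pa Pb xab ay bz]]] := cone_riesz cP Px Py Pz h.
suff -> : x = a by [].
rewrite xab [b]d ?addr0 //; rewrite xab; exact: cle_addl.
Qed.

(** The sum of two disjoint positive elements is their supremum. *)
Lemma disj_add_le x y w : P x -> P y -> x ⊑ w -> y ⊑ w -> disj x y -> x + y ⊑ w.
Proof.
move=> Px Py xw yw d; suff : x ⊑ w - y by rewrite /cone_le opprD addrA addrAC.
by apply: disj_le_cancel (y) Px yw Py _ d; rewrite subrK.
Qed.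

Lemma disj_sum_le (I : finType) (F : I -> V) w :
  (forall i, P (F i)) -> (forall i j, i != j -> disj (F i) (F j)) -> P w ->
  (forall i, F i ⊑ w) -> \sum_i F i ⊑ w.
Proof.
move=> PF d Pw le.
have PS (s : seq I) : P (\sum_(i <- s) F i).
  by elim/big_rec: _ => [|k x _ Px]; [apply: cone0|apply: coneD].
have dS i (s : seq I) : i \notin s -> disj (F i) (\sum_(j <- s) F j).
  elim: s => [|j s IH]; first by rewrite big_nil => _; apply: disj0.
  by rewrite inE negb_or big_cons => /andP[/d dij /IH]; apply: disjD.
suff h : forall s : seq I, uniq s -> \sum_(i <- s) F i ⊑ w.
  by rewrite -big_enum; apply: h; apply: enum_uniq.
elim=> [|i s IH] /=; first by rewrite big_nil => _; apply: cle0.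
case/andP=> nis us; rewrite big_cons.
by apply: disj_add_le; [apply: PF|apply: PS|apply: le|apply: IH|apply: dS].
Qed.

(** In other words, [p] is the supremum of [p - q] and [0]. *)
Lemma split_le p q y : P p -> P q -> P y -> disj p q -> p - q ⊑ y -> p ⊑ y.
Proof.
move=> Pp Pq Py d h; apply: disj_le_cancel Pq _ d => //.
by move: h; rewrite /cone_le opprB addrA.
Qed.

Lemma riesz_sum m x (F : 'I_m -> V) : P x -> (forall i, P (F i)) ->
  x ⊑ \sum_i F i ->
  exists a : 'I_m -> V, x = \sum_i a i /\ forall i, P (a i) /\ a i ⊑ F i.
Proof.
elim: m x F => [|m IH] x F Px PF.
  rewrite big_ord0 => /(cle_le0 Px) ->; exists (fun=> 0); split=> [|[]//].
  by rewrite big_ord0.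
rewrite big_ord_recl => h.
have PS : P (\sum_i F (lift ord0 i)) by apply: cone_sum => j _.
have [a [b [Pa Pb -> aF bF]]] := cone_riesz cP Px (PF _) PS h.
have [c [-> cF]] := IH _ _ Pb (fun i => PF (lift ord0 i)) bF.
exists (fun i => if unlift ord0 i is Some j then c j else a); split.
  by rewrite big_ord_recl unlift_none; congr (_ + _); apply: eq_bigr => j _; rewrite liftK.
by move=> i; case: unliftP => [j ->|->].
Qed.

End LGroup.

(** * Real coordinates on an archimedean order ideal *)

(** The set of positive elements of a convex subgroup, which determines it. *)
Record order_ideal (V : zmodType) (P I : set V) : Prop := OrderIdeal {
  ideal_pos : forall x, I x -> P x;
  ideal0 : I 0;
  idealD : forall x y, I x -> I y -> I (x + y);
  ideal_down : forall x y, I x -> P y -> cone_le P y x -> I y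
}.

Definition archimedean_on (V : zmodType) (P I : set V) : Prop :=
  forall x y, P x -> I y -> (forall k, cone_le P (x *+ k) y) -> x = 0.

(** A maximal disjoint family of basic elements: [frame_basic] says that the
    interval from [0] to [t i] is a chain. *)
Record frame (V : zmodType) (P I : set V) (m : nat) (t : 'I_m -> V) : Prop := Frame {
  frame_mem : forall i, I (t i);
  frame_neq0 : forall i, t i <> 0;
  frame_disj : forall i j, i != j -> disjoint_in P (t i) (t j);
  frame_basic : forall i a b, P a -> P b -> cone_le P a (t i) -> cone_le P b (t i) ->
    disjoint_in P a b -> a = 0 \/ b = 0;
  frame_full : forall x, I x -> (forall i, disjoint_in P x (t i)) -> x = 0
}.

Definition positive_additive (V : zmodType) (K : realType) (I : set V) (phi : V -> K) :=
  (forall x y, I x -> I y -> phi (x + y) = phi x + phi y) /\ (forall x, I x -> 0 <= phi x).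

(** The real ratio of [x] to [t], as in the embedding of an archimedean chain
    into the reals; for a basic [t] it only sees the component of [x] along [t]. *)
Definition frame_coord (V : zmodType) (P : set V) (K : realType) (t x : V) : K :=
  sup [set r : K | exists p k : nat,
    r = p%:R / k.+1%:R /\ cone_le P (t *+ p) (x *+ k.+1)].

Section Frame.
Variables (V : zmodType) (P : set V) (cP : lgroup_cone P) (K : realType).
Variables (I : set V) (iI : order_ideal P I) (aI : archimedean_on P I).
Variables (m : nat) (t : 'I_m -> V) (ft : frame P I t).
Local Notation "x '⊑' y" := (cone_le P x y) (at level 70).
Local Notation disj := (disjoint_in P).
Local Notation h i x := (frame_coord P K (t i) x).

Let tP i : P (t i). Proof. exact/(ideal_pos iI)/(frame_mem ft). Qed.

Lemma idealMn x k : I x -> I (x *+ k).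
Proof.
move=> Ix; elim: k => [|k IH]; first by rewrite mulr0n; apply: ideal0 iI.
by rewrite mulrS; apply: (idealD iI).
Qed.

Lemma frame_Mn_inj i p k : t i *+ p ⊑ t i *+ k -> (p <= k)%N.
Proof.
move=> le; case: leqP => // kp; case: (@frame_neq0 _ _ _ _ _ ft i).
apply: (cle_le0 cP) => //; have : t i *+ k.+1 ⊑ t i *+ k.
  by apply: (cle_trans cP) le; apply: cleMnr.
by rewrite mulrSr /cone_le opprD addrA subrr.
Qed.

(** If [x] fails to dominate [N t], then [x] is below [N t] up to an error
    that [t] does not see: below a basic element only one of the two disjoint
    parts of [N t - x] can survive, and here it is the positive one. *)
Lemma frame_cut i x N : P x -> ~ (t i *+ N ⊑ x) ->
  exists q, [/\ P q, disj q (t i) & x ⊑ t i *+ N + q].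
Proof.
move=> Px nle; have [p [q [Pp Pq e d]]] := cone_split cP (t i *+ N - x).
have xE : x = t i *+ N + q - p.
  by rewrite -addrA -[q - p]opprB -e opprB addrC subrK.
exists q; split=> //; last by rewrite xE; apply: cle_subl.
have ptN : p ⊑ t i *+ N.
  apply: split_le d _ => //; first exact: coneMn.
  by rewrite -e; apply: cle_subl.
have [pt|] := pselect (disj p (t i)).
  have p0 : p = 0.
    apply: (disj_self cP) => //; apply: disjC; apply: disj_le ptN => //.
    by apply: disjC; apply: disjMn.
  by case: nle; rewrite xE p0 subr0; apply: cle_addr.
move=> /existsNP[p']; move=> /not_implyP[Pp'] /not_implyP[p'p] /not_implyP[p't p'0].
move=> e' Pe' e'q e't.
case: (frame_basic ft Pp' Pe' p't e't) => //.
by apply: disj_le p'p => //; apply: disjC; apply: disj_le e'q => //; apply: disjC.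
Qed.

Lemma frame_bracket i x : I x ->
  exists N q, [/\ P q, disj q (t i), t i *+ N ⊑ x & x ⊑ t i *+ N.+1 + q].
Proof.
move=> Ix; have Px := ideal_pos iI Ix.
have [B nB] : exists B, ~ (t i *+ B ⊑ x).
  apply/existsNP => le; exact: (frame_neq0 ft (aI (tP i) Ix le)).
have [N []] : exists N, t i *+ N ⊑ x /\ ~ (t i *+ N.+1 ⊑ x).
  elim: B nB => [|B IH] nB; first by case: nB; rewrite mulr0n; apply: (cle0 Px).
  by have [/IH//|] := pselect (~ t i *+ B ⊑ x) => /contrapT; exists B.
move=> leN /(frame_cut Px)[q [Pq dq lq]].
by exists N, q; split.
Qed.

(** A term disjoint from [t i] does not contribute to the coordinate. *)
Lemma coord_ub_aux i x M N q p k : P x -> P q -> disj q (t i) ->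
  x *+ M.+1 ⊑ t i *+ N + q -> t i *+ p ⊑ x *+ k.+1 ->
  p%:R / k.+1%:R <= N%:R / M.+1%:R :> K.
Proof.
move=> Px Pq dq le1 le2; rewrite ler_pdivrMr ?ltr0Sn // mulrAC ler_pdivlMr ?ltr0Sn //.
rewrite -!natrM ler_nat; apply: (@frame_Mn_inj i).
apply: (@disj_le_cancel _ _ cP _ _ (q *+ k.+1)); try exact: coneMn.
  rewrite mulrnA [t i *+ (_ * _)]mulrnA -mulrnDl.
  apply: (cle_trans cP) (cleMn cP _ le1).
  by rewrite [x *+ _ *+ _]mulrnAC; apply: cleMn.
by apply: disjMn => //; apply: disjC; apply: disjMn => //; exact: disjC.
Qed.

Lemma coord_le i x M N q : P x -> P q -> disj q (t i) ->
  x *+ M.+1 ⊑ t i *+ N + q -> h i x <= N%:R / M.+1%:R.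
Proof.
move=> Px Pq dq le1; apply: ge_sup.
  exists 0, 0%N, 0%N; split; first by rewrite mul0r.
  rewrite mulr0n; apply: cle0; exact: coneMn.
by move=> _ [p [k [-> le2]]]; apply: coord_ub_aux le1 le2.
Qed.

Lemma coord_ge i x M N : I x -> t i *+ N ⊑ x *+ M.+1 -> N%:R / M.+1%:R <= h i x.
Proof.
move=> Ix le; apply: ub_le_sup; last by exists N, M.
have [B [q [Pq dq _ le1]]] := frame_bracket i Ix.
exists (B.+1%:R / 1) => _ [p [k [-> le2]]].
by apply: (@coord_ub_aux i x 0 _ q) => //; apply: ideal_pos Ix.
Qed.

(** Each precision [1 / M.+1] gives bounds on [x] by multiples of [t i] and on
    its coordinate by the same numbers. *)
Lemma coord_bracket i x M : I x -> exists N q, [/\ P q, disj q (t i),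
  t i *+ N ⊑ x *+ M.+1, x *+ M.+1 ⊑ t i *+ N.+1 + q &
  N%:R / M.+1%:R <= h i x <= N.+1%:R / M.+1%:R].
Proof.
move=> Ix; have [N [q [Pq dq le1 le2]]] := frame_bracket i (idealMn M.+1 Ix).
exists N, q; split=> //; rewrite coord_ge //=; apply: coord_le le2 => //.
exact: ideal_pos Ix.
Qed.

Lemma ler_all_natr (x y c : K) :
  (forall M : nat, (x - y) * M.+1%:R <= c) -> x <= y.
Proof.
move=> le; rewrite leNgt; apply/negP => yx.
have d0 : 0 < x - y by rewrite subr_gt0.
have := le (Num.truncn (c / (x - y))); rewrite -ler_pdivlMl // leNgt mulrC.
by rewrite truncnS_gt.
Qed.

Lemma coord_positive_additive i : positive_additive I (fun x => h i x).
Proof.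
split=> [x y Ix Iy|x Ix]; last first.
  have := @coord_ge i x 0 0 Ix; rewrite mulr0n mul0r; apply.
  by apply: cle0; apply: coneMn => //; exact: ideal_pos Ix.
(* Both sides lie in a common interval of length [2 / M.+1]. *)
suff H M : exists r : K, r / M.+1%:R <= h i (x + y) <= (r + 2) / M.+1%:R /\
    r / M.+1%:R <= h i x + h i y <= (r + 2) / M.+1%:R.
  apply/eqP; rewrite eq_le; apply/andP; split; apply: (@ler_all_natr _ _ 2) => M;
  have [r []] := H M; rewrite !ler_pdivrMr ?ler_pdivlMr ?ltr0Sn // mulrBl.
    by move=> /andP[_ h1] /andP[h2 _]; rewrite lerBlDr (le_trans h1) // addrC lerD2l.
  by move=> /andP[h1 _] /andP[_ h2]; rewrite lerBlDr (le_trans h2) // addrC lerD2l.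
have [N [q [Pq dq l1 l2 /andP[l3 l4]]]] := coord_bracket i M Ix.
have [N' [q' [Pq' dq' l1' l2' /andP[l3' l4']]]] := coord_bracket i M Iy.
exists (N + N')%:R; rewrite -natrD -[(_ + N' + 2)%N]addnA.
have -> : (N + (N' + 2) = N.+1 + N'.+1)%N by rewrite addn2 addSnnS.
split; apply/andP; split.
- apply: coord_ge; first exact: (idealD iI).
  by rewrite mulrnDr mulrnDl; apply: cleD.
- apply: (@coord_le _ _ _ _ (q + q')); first by apply: coneD => //; apply: (ideal_pos iI).
  + exact: coneD.
  + by apply: disjC; apply: disjD => //; exact: disjC.
  + by rewrite mulrnDr mulrnDl addrACA; apply: cleD.
- by rewrite natrD mulrDl lerD.
- by rewrite natrD mulrDl lerD.
Qed.

Lemma coord_frame i j : h i (t j) = (i == j)%:R.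
Proof.
have It := frame_mem ft.
have Ph := coord_positive_additive i.
apply/eqP; rewrite eq_le; apply/andP; split; case: eqVneq => [<-|ij].
- have := @coord_le i (t i) 0 1 0; rewrite divr1; apply => //.
  + exact: cone0.
  + by apply: disjC; apply: disj0.
  + by rewrite addr0; apply: cle_refl.
- have := @coord_le i (t j) 0 0 (t j); rewrite mul0r; apply => //.
  + by apply: (frame_disj ft); rewrite eq_sym.
  + by rewrite mulr0n add0r; apply: cle_refl.
- have := @coord_ge i (t i) 0 1 (It i); rewrite divr1; apply; exact: cle_refl.
- exact: Ph.2.
Qed.

(** An element that misses each [B i t i] only by something disjoint from
    [t i] lies below their sum, because the excess over the sum is disjoint from
    the whole frame. *)
Lemma le_sum_frame x (B : 'I_m -> nat) (q : 'I_m -> V) : I x ->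
  (forall i, P (q i) /\ disj (q i) (t i)) -> (forall i, x ⊑ t i *+ B i + q i) ->
  x ⊑ \sum_i t i *+ B i.
Proof.
move=> Ix hq le; have Px := ideal_pos iI Ix.
have PtB i : P (t i *+ B i) by apply: coneMn.
have PS : P (\sum_i t i *+ B i) by apply: cone_sum.
have [p [r [Pp Pr e d]]] := cone_split cP (x - \sum_i t i *+ B i).
suff p0 : p = 0 by rewrite /cone_le -opprB e p0 sub0r opprK.
apply: (frame_full ft).
  apply: (ideal_down iI Ix) => //; apply: split_le d _ => //.
  by rewrite -e; apply: cle_subl.
move=> i; have [Pq dq] := hq i; apply: disj_le dq _ => //.
apply: split_le d _ => //; rewrite -e.
apply: (@cle_trans _ _ cP (x - t i *+ B i)).
  rewrite /cone_le opprB addrC addrA subrK.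
  exact: (cle_bigD cP i PtB).
by move: (le i); rewrite /cone_le opprB addrA [q i + _]addrC.
Qed.

(** An element of an archimedean lattice is squeezed between multiples of
    its frame, so that its positive functionals are determined by the frame. *)
Lemma positive_functional_coord (phi : V -> K) x : positive_additive I phi -> I x ->
  phi x = \sum_j phi (t j) * h j x.
Proof.
move=> [phiD phi_ge0] Ix.
have It := frame_mem ft.
have phi0 : phi 0 = 0.
  by apply: (@addrI _ (phi 0)); rewrite -phiD ?addr0 //; apply: ideal0 iI.
have phiMn y k : I y -> phi (y *+ k) = phi y * k%:R.
  move=> Iy; elim: k => [|k IH]; first by rewrite mulr0n phi0 mulr0.
  by rewrite mulrS phiD ?IH //; [rewrite -natr1 mulrDr mulr1 addrC|apply: idealMn].
have Isum (B : 'I_m -> nat) : I (\sum_i t i *+ B i).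
  by elim/big_rec: _ => [|i y _ Iy]; [exact: ideal0 iI|apply: (idealD iI) => //; apply: idealMn].
have phi_sum (B : 'I_m -> nat) : phi (\sum_i t i *+ B i) = \sum_i phi (t i) * (B i)%:R.
  suff [] : I (\sum_i t i *+ B i) /\ phi (\sum_i t i *+ B i) = \sum_i phi (t i) * (B i)%:R by [].
  elim/big_rec2: _ => [|i y z _ [Iz e]]; first by split; [exact: ideal0 iI|].
  have Iti : I (t i *+ B i) by apply: idealMn.
  by split; [apply: (idealD iI)|rewrite phiD // phiMn // e].
have phi_le y z : I y -> I z -> y ⊑ z -> phi y <= phi z.
  move=> Iy Iz yz; rewrite -[z](subrK y) phiD //; last first.
    by apply: (ideal_down iI Iz) => //; apply: cle_subl => //; apply: ideal_pos Iy.
  rewrite lerDr phi_ge0 //; apply: (ideal_down iI Iz) => //.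
  by apply: cle_subl => //; apply: ideal_pos Iy.
set c := \sum_i phi (t i).
(* Scaled by [M.+1], both sides lie in an interval of fixed length [c]. *)
suff H M : exists r : K, r <= phi x * M.+1%:R <= r + c /\
    r <= (\sum_j phi (t j) * h j x) * M.+1%:R <= r + c.
  apply/eqP; rewrite eq_le; apply/andP; split; apply: (@ler_all_natr _ _ c) => M;
  have [r []] := H M; rewrite mulrBl.
    by move=> /andP[_ h1] /andP[h2 _]; rewrite lerBlDr (le_trans h1) // addrC lerD2l.
  by move=> /andP[h1 _] /andP[_ h2]; rewrite lerBlDr (le_trans h2) // addrC lerD2l.
have [N HN] := choice (fun i => coord_bracket i M Ix).
have [q Hq] := choice HN.
exists (\sum_i phi (t i) * (N i)%:R).
have -> : \sum_i phi (t i) * (N i)%:R + c = \sum_i phi (t i) * (N i).+1%:R.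
  by rewrite -big_split; apply: eq_bigr => i _; rewrite -natr1 mulrDr mulr1.
rewrite -!phi_sum -phiMn //; split; apply/andP; split.
- apply: phi_le => //; first exact: idealMn.
  apply: disj_sum_le => //.
  + by move=> i; apply: coneMn.
  + move=> i j ij; apply: disjMn => //; apply: disjC; apply: disjMn => //.
    by apply: (frame_disj ft); rewrite eq_sym.
  + by apply: coneMn => //; apply: ideal_pos Ix.
  + by move=> i; case: (Hq i).
- apply: phi_le => //; first exact: idealMn.
  apply: (@le_sum_frame _ _ q); first exact: idealMn.
  + by move=> i; case: (Hq i).
  + by move=> i; case: (Hq i).
- rewrite phi_sum mulr_suml; apply: ler_sum => i _; rewrite -mulrA ler_wpM2l ?phi_ge0 //.
  by case: (Hq i) => _ _ _ _ /andP[]; rewrite ler_pdivrMr ?ltr0Sn.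
- rewrite phi_sum mulr_suml; apply: ler_sum => i _; rewrite -mulrA ler_wpM2l ?phi_ge0 //.
  by case: (Hq i) => _ _ _ _ /andP[] _; rewrite ler_pdivlMr ?ltr0Sn.
Qed.

Lemma frame_coordinates : exists h : 'I_m -> V -> K,
  [/\ forall i, positive_additive I (h i), forall i j, h i (t j) = (i == j)%:R &
   forall phi x, positive_additive I phi -> I x -> phi x = \sum_j phi (t j) * h j x].
Proof.
exists (fun i x => frame_coord P K (t i) x); split.
- exact: coord_positive_additive.
- exact: coord_frame.
- exact: positive_functional_coord.
Qed.

End Frame.

(** * The Perron eigenvector of a positive matrix *)

(** The quotient [s] of [r - r.[a]%:P] by ['X - a%:P] is bounded near [a], so that
    a negative value of [r] at [a] would persist slightly to the right. *)
Lemma horner_ge0_right (K : realFieldType) (r : {poly K}) (a : K) :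
  (forall c, a < c -> 0 <= r.[c]) -> 0 <= r.[a].
Proof.
move=> r_ge0; rewrite leNgt; apply/negP => ra0.
have /factor_theorem[s rE] : root (r - r.[a]%:P) a.
  by rewrite rootE !hornerE subrr.
have [b hb] := poly_disk_bound s (`|a| + 1).
have b_ge0 : 0 <= b by apply: le_trans (hb a _); rewrite ?lerDl.
(* [e] keeps [a + e] in the disk where [b] bounds [s], and [b * e < - r.[a]]. *)
pose e := Num.min 1 (- r.[a] / (b + 1) / 2).
have b1 : 0 < b + 1 by rewrite ltr_wpDl.
have e0 : 0 < e by rewrite lt_min ltr01 !divr_gt0 ?oppr_gt0.
have := r_ge0 (a + e); rewrite ltrDl => /(_ e0); apply/negP; rewrite -ltNge.
have -> : r.[a + e] = r.[a] + s.[a + e] * e.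
  have := congr1 (horner^~ (a + e)) rE.
  rewrite hornerD hornerN hornerC => /eqP; rewrite subr_eq => /eqP ->.
  by rewrite hornerM hornerXsubC [X in _ * X]addrAC subrr add0r addrC.
have sb : s.[a + e] <= b.
  apply: le_trans (ler_norm _) (hb _ _).
  by rewrite (le_trans (ler_normD _ _)) // lerD2l gtr0_norm // ge_min lexx.
rewrite addrC -ltrBrDr sub0r.
apply: le_lt_trans (_ : _ <= b * e) _; first by rewrite ler_pM2r.
apply: le_lt_trans (_ : _ <= (b + 1) * e) _; first by rewrite ler_pM2r // lerDl.
apply: le_lt_trans (_ : _ <= - r.[a] / 2) _.
  rewrite mulrC -ler_pdivlMr // ge_min; apply/orP; right.
  by rewrite -!mulrA [2^-1 * _]mulrC.
by rewrite ltr_pdivrMr // mulr2n mulrDr mulr1 ltrDl oppr_gt0.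
Qed.

Lemma positive_family_lower_bound (K : realFieldType) m (u : 'I_m -> K) :
  (forall i, 0 < u i) -> exists2 d, 0 < d & forall i, d <= u i.
Proof.
move=> u0; exists (1 + \sum_i (u i)^-1)^-1.
  by rewrite invr_gt0 ltr_wpDr // sumr_ge0 // => i _; rewrite invr_ge0 ltW.
move=> i; rewrite -[u i]invrK lef_pV2 ?posrE ?invr_gt0 //; last first.
  by rewrite ltr_wpDr // sumr_ge0 // => j _; rewrite invr_ge0 ltW.
rewrite (bigD1 i) //= addrCA lerDl addr_ge0 // sumr_ge0 // => j _.
by rewrite invr_ge0 ltW.
Qed.

Section Perron.
Variables (K : realType) (m : nat) (S : 'M[K]_m).
Hypotheses (m_gt0 : (0 < m)%N) (S_gt0 : forall i j, 0 < S i j).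

Let nonneg_col (x : 'cV[K]_m) := forall i, 0 <= x i 0.
(** The subeigenvalues of [S]; their supremum is the Perron root. *)
Let subeigen : set K := fun c => exists x : 'cV[K]_m,
  [/\ nonneg_col x, x != 0 & forall i, c * x i 0 <= (S *m x) i 0].
Let lambda := sup subeigen.

Lemma mul_pos_col x i : nonneg_col x -> 0 <= (S *m x) i 0.
Proof. by move=> x0; rewrite mxE sumr_ge0 // => j _; rewrite mulr_ge0 // ltW. Qed.

Lemma mul_pos_col_gt0 x i : nonneg_col x -> x != 0 -> 0 < (S *m x) i 0.
Proof.
move=> x0 /cV0Pn[k xk]; rewrite mxE (bigD1 k) //= ltr_wpDr //.
  by rewrite sumr_ge0 // => j _; rewrite mulr_ge0 // ltW.
by rewrite mulr_gt0 // lt0r xk; apply: x0.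
Qed.

Lemma sum_nonneg_col_gt0 x : nonneg_col x -> x != 0 -> 0 < \sum_i x i 0.
Proof.
move=> x0 /cV0Pn[k xk]; rewrite (bigD1 k) //= ltr_wpDr //.
  by rewrite sumr_ge0 // => j _; apply: x0.
by rewrite lt0r xk; apply: x0.
Qed.

Lemma sum_mul_col_le (A : 'M[K]_m) (x : 'cV[K]_m) :
  (forall i j, 0 <= A i j) -> nonneg_col x ->
  \sum_i (A *m x) i 0 <= (\sum_i \sum_j A i j) * \sum_i x i 0.
Proof.
move=> A0 x0; rewrite mulr_suml; apply: ler_sum => i _; rewrite mxE mulr_suml.
apply: ler_sum => j _; rewrite ler_wpM2l // (bigD1 j) //= lerDl sumr_ge0 //.
Qed.

Lemma subeigen0 : subeigen 0.
Proof.
exists (const_mx 1); split; first by move=> i; rewrite mxE.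
- by apply/cV0Pn; exists (Ordinal m_gt0); rewrite mxE oner_eq0.
- by move=> i; rewrite mul0r; apply: mul_pos_col => j; rewrite mxE.
Qed.

Lemma has_ubound_subeigen : has_ubound subeigen.
Proof.
exists (\sum_i \sum_j S i j) => c [x [x0 xn0 h]].
rewrite -(ler_pM2r (sum_nonneg_col_gt0 x0 xn0)).
apply: le_trans (sum_mul_col_le _ x0); last by move=> i j; apply: ltW.
by rewrite mulr_sumr; apply: ler_sum.
Qed.

Lemma lambda_ge0 : 0 <= lambda.
Proof. exact: (ub_le_sup has_ubound_subeigen subeigen0). Qed.

(** Beyond the supremum the resolvent is positive: the negative part of a
    solution would be a subeigenvector. *)
Lemma resolvent_nonneg c (x : 'cV[K]_m) : lambda < c ->
  (forall i, (S *m x) i 0 <= c * x i 0) -> nonneg_col x.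
Proof.
move=> lc h; pose z : 'cV[K]_m := \col_i Num.max (- x i 0) 0.
have z0 : nonneg_col z by move=> i; rewrite mxE le_max lexx orbT.
have [/colP zE|zn0] := eqVneq z 0.
  move=> i; have := zE i; rewrite !mxE => zi.
  by rewrite -oppr_le0 -zi le_max lexx.
have := ub_le_sup has_ubound_subeigen (_ : subeigen c).
rewrite leNgt lc => h'; have // : false; apply: h'.
exists z; split=> // i; rewrite [z i 0]mxE maxEle; case: (leP (- x i 0) 0) => xi.
  by rewrite mulr0 mul_pos_col.
rewrite mulrN -[(S *m z) i 0]opprK lerN2; apply: le_trans (h i).
rewrite -subr_ge0 opprK.
have -> : (S *m x) i 0 + (S *m z) i 0 = (S *m (x + z)) i 0.
  by rewrite mulmxDr [RHS]mxE.
by apply: mul_pos_col => j; rewrite !mxE -lerBlDl sub0r le_max lexx.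
Qed.

(** If [lambda] were not an eigenvalue, then by continuity the resolvent would
    be nonnegative at [lambda] too, and it would bound a subeigenvector for [c]
    by [lambda - c] times a constant multiple of itself, which is absurd for [c]
    close to [lambda]. The determinant is kept as a factor instead of being
    inverted, so that continuity is only needed for polynomials in [c]. *)
Lemma perron_root_eigen : exists2 y : 'cV[K]_m, y != 0 & S *m y = lambda *: y.
Proof.
pose B c := c%:M - S; pose p := char_poly S.
have BE c : B c = map_mx (horner_eval c) (char_poly_mx S).
  by apply/matrixP => i j; rewrite !mxE /horner_eval !hornerE hornerMn hornerX.
have detB c : \det (B c) = p.[c] by rewrite BE det_map_mx.
have adjB c i j : (\adj (B c)) i j = ((\adj (char_poly_mx S)) i j).[c].
  by rewrite BE -map_mx_adj mxE.
have nn c i j : lambda < c -> 0 <= (\adj (B c)) i j * \det (B c).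
  move=> lc; pose x := \det (B c) *: col j (\adj (B c)).
  suff : nonneg_col x by move/(_ i); rewrite !mxE mulrC.
  apply: (resolvent_nonneg lc) => k; rewrite -subr_ge0.
  have -> : c * x k 0 - (S *m x) k 0 = (B c *m x) k 0.
    by rewrite mulmxBl mul_scalar_mx !mxE.
  rewrite -scalemxAr colE mulmxA mul_mx_adj mul_scalar_mx !mxE mulrA.
  by rewrite mulr_ge0 ?ler0n // -expr2 sqr_ge0.
have nnl i j : 0 <= (\adj (B lambda)) i j * \det (B lambda).
  rewrite adjB detB -hornerM; apply: horner_ge0_right => c lc.
  by rewrite hornerM -adjB -detB nn.
have [/eqP d0|dn0] := eqVneq (\det (B lambda)) 0.
  move: d0; rewrite -det_tr => /det0P[v vn0 /(congr1 trmx)].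
  rewrite trmx_mul trmxK trmx0 => h; exists v^T.
    by rewrite -trmx0 (inj_eq trmx_inj).
  by move/eqP: h; rewrite mulmxBl mul_scalar_mx subr_eq0 => /eqP.
exfalso; pose A := \det (B lambda) *: \adj (B lambda).
have A0 i j : 0 <= A i j by rewrite mxE mulrC.
have AB : A *m B lambda = (\det (B lambda) ^+ 2)%:M.
  by rewrite -scalemxAl mul_adj_mx scale_scalar_mx expr2.
set d := \det (B lambda) ^+ 2 in AB.
have d_gt0 : 0 < d by rewrite exprn_even_gt0 //= dn0.
pose beta := \sum_i \sum_j A i j.
have beta0 : 0 <= beta by rewrite sumr_ge0 // => i _; rewrite sumr_ge0.
have e0 : 0 < d / (beta + 1) by rewrite divr_gt0 // ltr_wpDl.
have [c Ec lc] := sup_adherent e0 (conj (ex_intro _ _ subeigen0) has_ubound_subeigen).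
have lc' : lambda - c < d / (beta + 1) by rewrite ltrBlDr addrC -ltrBlDr.
have cl : 0 <= lambda - c by rewrite subr_ge0; apply: ub_le_sup Ec; apply: has_ubound_subeigen.
case: Ec => x [x0 xn0 h].
have xs := sum_nonneg_col_gt0 x0 xn0.
have : d * (\sum_i x i 0) <= (lambda - c) * beta * \sum_i x i 0.
  rewrite -mulrA; apply: le_trans (ler_wpM2l cl (sum_mul_col_le A0 x0)).
  rewrite !mulr_sumr; apply: ler_sum => i _.
  have -> : d * x i 0 = (A *m (B lambda *m x)) i 0.
    by rewrite mulmxA AB mul_scalar_mx mxE.
  rewrite !mxE mulr_sumr; apply: ler_sum => j _; rewrite mulrCA.
  have -> : (B lambda *m x) j 0 = lambda * x j 0 - (S *m x) j 0.
    by rewrite mulmxBl mul_scalar_mx !mxE.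
  by rewrite ler_wpM2l // mulrBl lerB.
rewrite ler_pM2r //; apply/negP; rewrite -ltNge.
apply: le_lt_trans (_ : _ <= (lambda - c) * (beta + 1)) _.
  by rewrite ler_wpM2l // lerDl.
by rewrite -ltr_pdivlMr // ltr_wpDl.
Qed.

(** The absolute value [z] of an eigenvector is subeigen for [lambda]; if it were
    not an eigenvector, [S *m z] would be subeigen for a number above [lambda]. *)
Lemma perron_vector : exists z : 'cV[K]_m, (forall i, 0 < z i 0) /\ S *m z = lambda *: z.
Proof.
have [y yn0 ey] := perron_root_eigen.
pose z : 'cV[K]_m := \col_i `|y i 0|.
have z0 : nonneg_col z by move=> i; rewrite mxE.
have zn0 : z != 0.
  by case/cV0Pn: yn0 => i yi; apply/cV0Pn; exists i; rewrite mxE normr_eq0.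
have lez i : lambda * z i 0 <= (S *m z) i 0.
  have -> : (S *m z) i 0 = \sum_j S i j * `|y j 0|.
    by rewrite mxE; apply: eq_bigr => j _; rewrite mxE.
  rewrite [z i 0]mxE -[X in X * _](ger0_norm lambda_ge0) -normrM.
  have -> : lambda * y i 0 = \sum_j S i j * y j 0.
    by have := congr1 (fun x : 'cV_m => x i 0) ey; rewrite !mxE.
  rewrite (le_trans (ler_norm_sum _ _ _)) //; apply: ler_sum => j _.
  by rewrite normrM gtr0_norm.
have ez : S *m z = lambda *: z.
  apply/eqP; rewrite -subr_eq0; apply/negPn/negP => wn0.
  set w := _ - _ in wn0.
  have w0 : nonneg_col w by move=> i; have := lez i; rewrite -subr_ge0 !mxE.
  pose x := S *m z.
  have x0 i : 0 < x i 0 by apply: mul_pos_col_gt0.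
  have [e e0 he] := positive_family_lower_bound (fun i => mul_pos_col_gt0 i w0 wn0).
  have s0 : 0 < \sum_i x i 0.
    by rewrite (bigD1 (Ordinal m_gt0)) //= ltr_wpDr // sumr_ge0 // => i _; apply: ltW.
  pose c := lambda + e / \sum_i x i 0.
  have := ub_le_sup has_ubound_subeigen (_ : subeigen c).
  rewrite leNgt ltrDl divr_gt0 // => h'; have // : false; apply: h'.
  exists x; split; first by move=> i; apply: ltW.
    by apply/cV0Pn; exists (Ordinal m_gt0); rewrite gt_eqF.
  move=> i; rewrite mulrDl addrC -lerBrDr.
  have -> : (S *m x) i 0 - lambda * x i 0 = (S *m w) i 0.
    by rewrite mulmxBr -scalemxAr !mxE.
  apply: le_trans (he i); rewrite -mulrA ger_pMr // mulrC ler_pdivrMr // mul1r.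
  by rewrite (bigD1 i) //= lerDl sumr_ge0 // => j _; apply: ltW.
exists z; split=> // i.
have := mul_pos_col_gt0 i z0 zn0; rewrite ez mxE.
by rewrite !lt0r z0 andbT mulf_eq0 negb_or => /andP[/andP[]].
Qed.

(** The Perron eigenspace is a line, hence every matrix commuting with [S]
    preserves it. *)
Lemma perron_commutant : exists2 z : 'cV[K]_m, z != 0 &
  forall Y : 'M[K]_m, Y *m S = S *m Y -> exists c, Y *m z = c *: z.
Proof.
have [z [z0 ez]] := perron_vector.
exists z; first by apply/cV0Pn; exists (Ordinal m_gt0); rewrite gt_eqF.
move=> Y YS; set y := Y *m z.
have ey : S *m y = lambda *: y by rewrite mulmxA -YS -mulmxA ez -scalemxAr.
(* The largest multiple of [z] below [y] leaves a vector with a zero entry. *)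
have [i0 _ hi0] := @arg_minP _ _ _ (Ordinal m_gt0) xpredT (fun i => y i 0 / z i 0) isT.
exists (y i0 0 / z i0 0); set c := _ / _.
apply/eqP; rewrite -subr_eq0; apply/negPn/negP => wn0; set w := _ - _ in wn0.
have wE i : w i 0 = y i 0 - c * z i 0 by rewrite !mxE.
have w0 : nonneg_col w.
  by move=> i; rewrite wE subr_ge0 -ler_pdivlMr //; apply: hi0.
have := mul_pos_col_gt0 i0 w0 wn0.
have -> : S *m w = lambda *: w.
  by rewrite mulmxBr ey -scalemxAr ez scalerBr !scalerA mulrC.
by rewrite mxE wE /c divfK ?gt_eqF // subrr mulr0 ltxx.
Qed.

End Perron.

(** * Representations of the matrix ring *)

Section Representation.
Variables (R : comNzRingType) (K : fieldType) (v : {rmorphism R -> K}).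
Variables (n m : nat) (rho : 'M[R]_n -> 'M[K]_m) (i0 : 'I_n).
Hypotheses (rhoD : {morph rho : X Y / X + Y})
  (rhoZ : forall r X, rho (r *: X) = v r *: rho X)
  (rhoM : forall X Y, rho (X *m Y) = rho X *m rho Y) (rho1 : rho 1%:M = 1%:M).

Let U i j := rho (delta_mx i j).

Lemma rep_sum (I : finType) (C : pred I) (F : I -> 'M[R]_n) :
  rho (\sum_(i | C i) F i) = \sum_(i | C i) rho (F i).
Proof.
apply: (big_morph rho rhoD); apply: (@addrI _ (rho 0)).
by rewrite -rhoD !addr0.
Qed.

Lemma repE X : rho X = \sum_i \sum_j v (X i j) *: U i j.
Proof.
rewrite {1}[X]matrix_sum_delta rep_sum; apply: eq_bigr => i _.
by rewrite rep_sum; apply: eq_bigr => j _; rewrite rhoZ.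
Qed.

Lemma repU i j k l : U i j *m U k l = if j == k then U i l else 0.
Proof.
rewrite /U -rhoM mul_delta_mx_cond; case: eqP => _; first by rewrite mulr1n.
by rewrite mulr0n -(scale0r (0 : 'M[R]_n)) rhoZ rmorph0 scale0r.
Qed.

Lemma repU1 : \sum_i U i i = 1%:M.
Proof.
rewrite -rho1 -rep_sum; congr rho; apply/matrixP => i j.
rewrite summxE (bigD1 i) //= big1 => [|k ki]; rewrite !mxE ?eqxx ?addr0 //.
  by rewrite eq_sym.
by rewrite eq_sym (negPf ki).
Qed.

(** The multiplicity of the standard module in the representation is the size
    of its commutant, and a commutant with a common eigenvector forces it to be
    one: for every [Y], the matrix [\sum_i U i i0 *m Y *m U i0 i] is in the
    commutant, so [U i0 i0] sends every vector into a single line. *)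
Lemma rep_conjugation (z : 'cV[K]_m) : z != 0 ->
  (forall Y : 'M[K]_m, (forall X, Y *m rho X = rho X *m Y) -> exists c, Y *m z = c *: z) ->
  exists (Q : 'M[K]_(m, n)) (Q' : 'M[K]_(n, m)),
    [/\ Q *m Q' = 1%:M, Q' *m Q = 1%:M & forall X, rho X = Q *m map_mx v X *m Q'].
Proof.
move=> zn0 comm_z.
have [j yn0] : exists j, U i0 j *m z != 0.
  apply/existsP; rewrite -negb_forall; apply: contraNN zn0 => /forallP h.
  rewrite -[z]mul1mx -repU1 mulmx_suml big1 // => j _.
  have -> : U j j = U j i0 *m U i0 j by rewrite repU eqxx.
  by rewrite -mulmxA (eqP (h j)) mulmx0.
have [y yE] : exists y, y = U i0 j *m z by exists (U i0 j *m z).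
rewrite -yE in yn0.
have Uy : U i0 i0 *m y = y by rewrite yE mulmxA repU eqxx.
have line x : exists c, U i0 i0 *m x = c *: y.
  have /cV0Pn[k yk] := yn0.
  pose Y : 'M[K]_m := x *m ((y k 0)^-1 *: delta_mx 0 k).
  have Yy : Y *m y = x.
    rewrite -mulmxA -scalemxAl -rowE [_ *: _]mx11_scalar !mxE mulVf //.
    by rewrite mulmx1.
  pose RY := \sum_i U i i0 *m Y *m U i0 i.
  have URY k1 l1 : U k1 l1 *m RY = U k1 i0 *m Y *m U i0 l1.
    rewrite mulmx_sumr (bigD1 l1) //= big1 => [|i il].
      by rewrite addr0 !mulmxA repU eqxx.
    by rewrite !mulmxA repU eq_sym (negPf il) !mul0mx.
  have RYU k1 l1 : RY *m U k1 l1 = U k1 i0 *m Y *m U i0 l1.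
    rewrite mulmx_suml (bigD1 k1) //= big1 => [|i il].
      by rewrite addr0 -!mulmxA repU eqxx.
    by rewrite -!mulmxA repU (negPf il) !mulmx0.
  have [X|c ec] := comm_z RY.
    rewrite repE mulmx_sumr mulmx_suml; apply: eq_bigr => k1 _.
    rewrite mulmx_sumr mulmx_suml; apply: eq_bigr => l1 _.
    by rewrite -scalemxAr -scalemxAl RYU URY.
  exists c; rewrite -[in LHS]Yy yE.
  have -> : U i0 i0 *m (Y *m (U i0 j *m z)) = U i0 j *m RY *m z by rewrite URY -!mulmxA.
  by rewrite -mulmxA ec -scalemxAr.
have /cV0Pn[k yk] := yn0.
pose w : 'rV[K]_m := (y k 0)^-1 *: delta_mx 0 k.
have wy : w *m y = 1%:M.
  by rewrite -scalemxAl -rowE [_ *: _]mx11_scalar !mxE mulVf.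
have [eta etaE] : exists eta, eta = w *m U i0 i0 by exists (w *m U i0 i0).
have Ue : U i0 i0 = y *m eta.
  apply/matrixP => a b; have [c ec] := line (delta_mx b 0).
  have e1 : U i0 i0 a b = c * y a 0.
    by have := congr1 (fun x : 'cV_m => x a 0) ec; rewrite -colE !mxE.
  have : eta *m delta_mx b 0 = c *: 1%:M by rewrite etaE -mulmxA ec -scalemxAr wy.
  rewrite -colE => /(congr1 (fun x : 'M_1 => x 0 0)); rewrite !mxE eqxx mulr1 => e2.
  by rewrite big_ord1 e2 e1 mulrC.
have ey : eta *m y = 1%:M by rewrite etaE -mulmxA Uy.
pose Q : 'M[K]_(m, n) := \matrix_(a, i) (U i i0 *m y) a 0.
pose Q' : 'M[K]_(n, m) := \matrix_(i, a) (eta *m U i0 i) 0 a.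
have colQ i : col i Q = U i i0 *m y by apply/colP => a; rewrite !mxE.
have rowQ' i : row i Q' = eta *m U i0 i by apply/rowP => a; rewrite !mxE.
exists Q, Q'.
have QXQ X : rho X = Q *m map_mx v X *m Q'.
  rewrite repE [X in _ *m X *m _]matrix_sum_delta mulmx_sumr mulmx_suml.
  apply: eq_bigr => i _; rewrite mulmx_sumr mulmx_suml.
  apply: eq_bigr => l _; rewrite mxE -scalemxAr -scalemxAl; congr (_ *: _).
  rewrite -(mul_delta_mx (0 : 'I_1)) mulmxA -colE -mulmxA -rowE colQ rowQ'.
  rewrite mulmxA -[U i i0 *m y *m eta]mulmxA -Ue.
  by rewrite repU eqxx repU eqxx.
split=> //.
  by rewrite -rho1 QXQ map_mx1 mulmx1.
apply/matrixP => i l.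
have -> : (Q' *m Q) i l = (row i Q' *m col l Q) 0 0.
  by rewrite !mxE; apply: eq_bigr => a _; rewrite !mxE.
rewrite rowQ' colQ mulmxA -[eta *m _ *m _]mulmxA repU.
case: (i =P l) => [->|/eqP il].
  by rewrite -mulmxA Uy ey !mxE !eqxx.
by rewrite mulmx0 mul0mx !mxE (negPf il).
Qed.

End Representation.

(** Schur's lemma for the full matrix ring. *)
Lemma comm_delta_scalar (K : fieldType) (n : nat) (Y : 'M[K]_n) (i0 : 'I_n) :
  (forall i j, Y *m delta_mx i j = delta_mx i j *m Y) -> exists c, Y = c%:M.
Proof.
move=> h; exists (Y i0 i0); apply/matrixP => i j; rewrite !mxE.
have := congr1 (fun A : 'M_n => A i i0) (h j i0).
have -> : (Y *m delta_mx j i0) i i0 = Y i j.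
  rewrite mxE (bigD1 j) //= big1 => [|k kj]; first by rewrite mxE !eqxx mulr1 addr0.
  by rewrite mxE (negPf kj) mulr0.
move=> ->; rewrite mxE (bigD1 i0) //= big1 => [|k kj].
  by rewrite mxE eqxx andbT addr0; case: eqP; rewrite ?mul1r ?mul0r.
by rewrite mxE (negPf kj) andbF mul0r.
Qed.

(** * Finite rank *)

Section Dependence.
Variables (R : comNzRingType) (K : fieldType) (v : {rmorphism R -> K}) (v_inj : injective v).

Lemma inj_mulf_eq0 (a b : R) : (a * b == 0) = (a == 0) || (b == 0).
Proof. by rewrite -!(inj_eq v_inj) rmorphM rmorph0 mulf_eq0. Qed.

(** Fraction-free elimination of one column at a time. *)
Lemma left_kernel_wide N k (A : 'M[R]_(k, N)) : (N < k)%N ->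
  exists2 r : 'rV[R]_k, r != 0 & r *m A = 0.
Proof.
elim: N k A => [|N IH] k A Nk.
  exists (const_mx 1); last by rewrite [A]thinmx0 mulmx0.
  by case: k A Nk => // k A _; apply/rV0Pn; exists 0; rewrite mxE oner_eq0.
case: k A Nk => // k A Nk.
have [c0|/cV0Pn[i ai]] := eqVneq (col 0 A) 0.
  have [|r rn0 rA] := IH k.+1 (col' 0 A); first exact: ltnW.
  exists r => //; apply/rowP => j; rewrite [RHS]mxE.
  have [->|[j' ->]] : j = 0 \/ exists j', j = lift 0 j'.
    by case: (unliftP 0 j) => [j' ->|->]; [right; exists j'|left].
  - rewrite mxE big1 // => l _; have /colP/(_ l) := c0; rewrite !mxE => ->.
    by rewrite mulr0.
  - have /rowP/(_ j') := rA; rewrite !mxE => h; rewrite -[RHS]h.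
    by apply: eq_bigr => l _; rewrite !mxE.
rewrite mxE in ai; set a := A i 0 in ai.
pose A' := \matrix_(l < k, j < N) (a * A (lift i l) (lift 0 j) - A (lift i l) 0 * A i (lift 0 j)).
have [r rn0 rA] := IH k A' Nk.
pose s := \row_(l < k.+1) if unlift i l is Some l' then a * r 0 l' else
  - \sum_l' r 0 l' * A (lift i l') 0.
have sE B : \sum_l s 0 l * B l = \sum_l r 0 l * (a * B (lift i l) - A (lift i l) 0 * B i).
  rewrite (bigD1_ord i) //= mxE unlift_none mulNr mulr_suml -sumrN -big_split /=.
  apply: eq_bigr => l _; rewrite mxE liftK addrC mulrBr; congr (_ - _).
    by rewrite -mulrA mulrCA.
  by rewrite mulrA.
exists s.
  have /rV0Pn[l rl] := rn0; apply/rV0Pn; exists (lift i l).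
  by rewrite mxE liftK inj_mulf_eq0 negb_or ai.
apply/rowP => j; rewrite mxE sE mxE.
have [->|[j' ->]] : j = 0 \/ exists j', j = lift 0 j'.
  by case: (unliftP 0 j) => [j' ->|->]; [right; exists j'|left].
- by rewrite big1 // => l _; rewrite -/a mulrC [a * _]mulrC subrr mul0r.
- have /rowP/(_ j') := rA; rewrite !mxE => h; rewrite -[RHS]h.
  by apply: eq_bigr => l _; rewrite mxE.
Qed.

Definition linearly_dependent (V : lmodType R) k (x : 'I_k -> V) :=
  exists2 r : 'I_k -> R, (exists i, r i != 0) & \sum_i r i *: x i = 0.

Lemma matrices_dependent n k (x : 'I_k -> 'M[R]_n) : (n * n < k)%N -> linearly_dependent x.
Proof.
move=> nk; have [r /rV0Pn[i ri] rA] := left_kernel_wide (\matrix_i mxvec (x i)) nk.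
exists (fun i => r 0 i); first by exists i.
apply: (can_inj mxvecK); rewrite linear0 linear_sum -[RHS]rA /=.
apply/rowP => j; rewrite summxE !mxE; apply: eq_bigr => l _.
by rewrite linearZ !mxE.
Qed.

End Dependence.

Section FiniteRank.
Variables (R : comNzRingType) (K : realType) (v : {rmorphism R -> K}).
Variables (V : lmodType R) (P : set V) (cP : lgroup_cone P)
  (Pscale : forall r x, 0 <= v r -> P x -> P (r *: x)).
Local Notation "x '⊑' y" := (cone_le P x y) (at level 70).
Local Notation disj := (disjoint_in P).

(** Once the relation is scaled to make the coefficient of [x i0] at least one,
    the other terms bound [x i0]. *)
Lemma dependence_le k (x : 'I_k -> V) (r : 'I_k -> R) i0 :
  (forall i, P (x i)) -> \sum_i r i *: x i = 0 -> v (r i0) != 0 ->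
  exists M, x i0 ⊑ (\sum_(i | i != i0) x i) *+ M.
Proof.
move=> Px rx ri0.
have [c hc] : exists c, 1 <= v (c * r i0).
  pose N := (Num.truncn (`|v (r i0)|^-1)).+1.
  have hN : 1 <= N%:R * `|v (r i0)|.
    by rewrite -ler_pdivrMr ?normr_gt0 // mul1r ltW // truncnS_gt.
  have [r0|r0] := ler0P (v (r i0)).
    exists (- N%:R); rewrite rmorphM rmorphN rmorph_nat mulNr -mulrN.
    by rewrite -(ler0_norm r0).
  by exists N%:R; rewrite rmorphM rmorph_nat -(gtr0_norm r0).
pose M := (Num.truncn (\sum_i `|v (c * r i)|)).+1.
have hM i : 0 <= v (M%:R + c * r i).
  rewrite rmorphD rmorph_nat -lerBlDr sub0r ltW //.
  apply: le_lt_trans (truncnS_gt _); apply: le_trans (_ : _ <= `|v (c * r i)|) _.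
    by rewrite -normrN ler_norm.
  by rewrite (bigD1 i) //= lerDl sumr_ge0.
exists M; rewrite /cone_le.
suff -> : (\sum_(i | i != i0) x i) *+ M - x i0 =
    \sum_(i | i != i0) (M%:R + c * r i) *: x i + (c * r i0 - 1) *: x i0.
  apply: coneD => //; last by apply: Pscale => //; rewrite rmorphB rmorph1 subr_ge0.
  by apply: cone_sum => // i _; apply: Pscale.
rewrite scalerBl scale1r addrA; congr (_ - _).
have : c *: (\sum_i r i *: x i) = 0 by rewrite rx scaler0.
rewrite scaler_sumr (bigD1 i0) //= scalerA addrC => e.
transitivity (\sum_(i | i != i0) (M%:R *: x i + c *: (r i *: x i)) + (c * r i0) *: x i0).
  by rewrite big_split /= -addrA e addr0 -scaler_sumr scaler_nat.
by congr (_ + _); apply: eq_bigr => i _; rewrite scalerDl scalerA.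
Qed.

Lemma disjoint_independent k (x : 'I_k -> V) : injective v ->
  (forall i, P (x i)) -> (forall i, x i <> 0) ->
  (forall i j, i != j -> disj (x i) (x j)) -> ~ linearly_dependent x.
Proof.
move=> v_inj Px xn0 d [r [i ri] rx].
have [|M le] := dependence_le Px rx (i0 := i).
  by rewrite -(rmorph0 v) (inj_eq v_inj).
apply: (xn0 i); apply: (disj_self cP (Px i)).
apply: disjC; apply: disj_le le => //; apply: disjC; apply: disjMn => //.
  by apply: cone_sum.
by apply: disj_sum => // j ji; apply: d; rewrite eq_sym.
Qed.

Definition extend_family k (x0 : V) (x : 'I_k -> V) (i : 'I_k.+1) : V :=
  if unlift ord0 i is Some j then x j else x0.

Lemma extend_family_disj k (x0 : V) (x : 'I_k -> V) :
  (forall i, disj x0 (x i)) -> (forall i j, i != j -> disj (x i) (x j)) ->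
  forall i j, i != j -> disj (extend_family x0 x i) (extend_family x0 x j).
Proof.
move=> d0 d i j; rewrite /extend_family.
case: (unliftP ord0 i) => [i' ->|->]; case: (unliftP ord0 j) => [j' ->|->] ij.
- by apply: d; apply: contraNneq ij => ->.
- exact/disjC/d0.
- exact: d0.
- by rewrite eqxx in ij.
Qed.

Lemma extend_family_all (Q : V -> Prop) k (x0 : V) (x : 'I_k -> V) :
  Q x0 -> (forall i, Q (x i)) -> forall i, Q (extend_family x0 x i).
Proof. by move=> q0 q i; rewrite /extend_family; case: unliftP. Qed.

(** A disjoint family of maximal size: an element that is not basic, or one
    that is disjoint from the family, would allow a larger one. *)
Lemma frame_exists (I : set V) N : injective v -> order_ideal P I ->
  (forall k (x : 'I_k -> V), (N < k)%N -> linearly_dependent x) ->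
  exists m (t : 'I_m -> V), frame P I t.
Proof.
move=> v_inj iI dep; pose F m := exists t : 'I_m -> V, [/\ forall i, I (t i),
  forall i, t i <> 0 & forall i j, i != j -> disj (t i) (t j)].
have exF : exists m, `[< F m >].
  by exists 0%N; apply/asboolP; exists (fun=> 0); split=> [] [].
have bF m : `[< F m >] -> (m <= N)%N.
  move=> /asboolP[t [It tn0 d]]; rewrite leqNgt; apply/negP => /dep h.
  by apply: (disjoint_independent v_inj _ tn0 d (h t)) => i; apply: (ideal_pos iI).
case: (ex_maxnP exF bF) => m /asboolP[t [It tn0 d]] max.
have maxF (x0 : V) (x : 'I_m -> V) : (forall i, I (x i)) -> (forall i, x i <> 0) ->
    (forall i j, i != j -> disj (x i) (x j)) -> I x0 -> (forall i, disj x0 (x i)) -> x0 = 0.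
  move=> Ix xn0 dx Ix0 dx0; apply: contrapT => x0n0.
  have /max : `[< F m.+1 >]; last by rewrite ltnn.
  apply/asboolP; exists (extend_family x0 x).
  split; last exact: extend_family_disj.
    exact: (extend_family_all (Q := I)).
  exact: (extend_family_all (Q := fun y => y <> 0)).
exists m, t; split=> // [i a b Pa Pb at_ bt dab|x Ix dx]; last exact: (maxF x t).
have [->|/eqP an0] := eqVneq a 0; [by left|right].
apply: (maxF b (fun j => if j == i then a else t j)).
- by move=> j; case: eqP => // _; apply: ideal_down at_.
- by move=> j; case: eqP.
- move=> j k jk; case: (j =P i) jk => [->|/eqP ji]; case: (k =P i) => [->|/eqP ki].
  + by rewrite eqxx.
  + by move=> ik; apply: disj_le at_ => //; apply: d.
  + by move=> _; apply: disjC; apply: disj_le at_ => //; apply: d; rewrite eq_sym.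
  + exact: d.
- exact: ideal_down bt.
- move=> j; case: eqP => [_|/eqP ji]; first exact: disjC.
  by apply: disj_le bt => //; apply: d; rewrite eq_sym.
Qed.

End FiniteRank.

(** * Minimal left ideals *)

Definition left_ideal (R : comNzRingType) n (P I : set 'M[R]_n) : Prop :=
  order_ideal P I /\ (forall A X, P A -> I X -> I (A *m X)).

Section MinimalLeftIdeal.
Variables (R : comNzRingType) (K : realType) (v : {rmorphism R -> K}) (v_inj : injective v).
Variables (n : nat) (P : set 'M[R]_n) (cP : lgroup_cone P)
  (Pmul : forall A B, P A -> P B -> P (A *m B))
  (Pscale : forall r A, 0 <= v r -> P A -> P (r *: A)) (P1 : P 1%:M) (n_gt0 : (0 < n)%N).
Local Notation "x '⊑' y" := (cone_le P x y) (at level 70).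
Local Notation disj := (disjoint_in P).

Lemma cle_mull A X Y : P A -> X ⊑ Y -> A *m X ⊑ A *m Y.
Proof. by move=> PA XY; rewrite /cone_le -mulmxBr; apply: Pmul. Qed.

Let nonzero (I : set 'M[R]_n) := exists2 X, I X & X <> 0.

(** The dimension of the span is measured by the least size for which all
    families are linearly dependent. In an ideal of least
    dimension, every nonzero left ideal has an element whose multiples dominate
    the whole; for the ideal of infinitesimal elements this is absurd. *)
Lemma minimal_left_ideal_exists : exists I, [/\ left_ideal P I, nonzero I,
  forall J, left_ideal P J -> (J `<=` I)%classic -> nonzero J -> (I `<=` J)%classic &
  archimedean_on P I].
Proof.
pose D k := exists I, [/\ left_ideal P I, nonzero I &
  forall x : 'I_k -> 'M[R]_n, (forall i, I (x i)) -> linearly_dependent x].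
have exD : exists k, `[< D k >].
  exists (n * n).+1; apply/asboolP; exists P; split.
  - by split=> //; split=> //; [apply: cone0|apply: coneD].
  - exists 1%:M => //; move/matrixP => /(_ (Ordinal n_gt0) (Ordinal n_gt0)).
    by rewrite !mxE eqxx => /eqP; rewrite oner_eq0.
  - by move=> x _; apply: (matrices_dependent v_inj).
case: (ex_minnP exD) => -[|k] /asboolP[I [[iI Imul] In0 dep]] min.
  by have [|r [[]]] := dep (fun=> 0) => // -[].
(* By the choice of [k], some [k] elements of [J] are independent; joined by any
   element of [I] they become dependent, so that their sum dominates it. *)
have unit_of (J : set 'M[R]_n) : left_ideal P J -> (J `<=` I)%classic -> nonzero J ->
    exists2 U, J U & forall X, I X -> exists M, X ⊑ U *+ M.
  move=> lJ JI Jn0; have iJ := lJ.1.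
  have [y Jy ndep] : exists2 y : 'I_k -> 'M[R]_n, (forall i, J (y i)) & ~ linearly_dependent y.
    apply: contrapT => h; suff /min : `[< D k >] by rewrite ltnn.
    apply/asboolP; exists J; split=> // y Jy; apply: contrapT => ny; apply: h.
    by exists y.
  exists (\sum_i y i).
    by elim/big_rec: _ => [|i x _ Jx]; [apply: ideal0 iJ|apply: (idealD iJ)].
  move=> X IX; have [|r rn0 rx] := dep (extend_family X y).
    by apply: (extend_family_all (Q := I)) => // i; apply: JI.
  have sumE (G : 'I_k.+1 -> 'M[R]_n) : \sum_(i | i != ord0) G i = \sum_i G (lift ord0 i).
    by rewrite big_mkcond big_ord_recl eqxx /= add0r.
  have yE i : extend_family X y (lift ord0 i) = y i by rewrite /extend_family liftK.
  have r0 : r ord0 != 0.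
    apply/negP => /eqP r0; apply: ndep; exists (fun i => r (lift ord0 i)).
      have [i ri] := rn0; case: (unliftP ord0 i) ri => [j ->|->]; first by exists j.
      by rewrite r0 eqxx.
    move: rx; rewrite big_ord_recl r0 scale0r add0r => h; rewrite -[RHS]h.
    by apply: eq_bigr => i _; rewrite yE.
  have Py : forall i, P (extend_family X y i).
    by apply: (extend_family_all (Q := P)) => [|i]; apply: (ideal_pos iI) => //; apply: JI.
  have [|M] := dependence_le cP Pscale Py rx (i0 := ord0).
    by rewrite -(rmorph0 v) (inj_eq v_inj).
  by rewrite sumE /extend_family unlift_none; under eq_bigr do rewrite liftK; exists M.
exists I; split=> //.
  move=> J lJ JI Jn0 X IX; have [U JU] := unit_of J lJ JI Jn0.
  move=> /(_ X IX)[M le]; apply: (ideal_down lJ.1) le; last exact: (ideal_pos iI).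
  elim: M => [|M IH]; first by rewrite mulr0n; apply: ideal0 lJ.1.
  by rewrite mulrS; apply: (idealD lJ.1).
move=> X Y PX IY inf; apply: contrapT => Xn0.
(* The infinitesimal elements of [I] form a left ideal. *)
pose J : set 'M[R]_n := fun X => P X /\ exists2 Y, I Y & forall k, X *+ k ⊑ Y.
have lJ : left_ideal P J.
  split; first split.
  - by move=> ? [].
  - split; first exact: cone0.
    by exists 0 => [|l]; [apply: ideal0 iI|rewrite mul0rn; apply: cle_refl].
  - move=> A B [PA [A' IA' hA]] [PB [B' IB' hB]]; split; first exact: coneD.
    by exists (A' + B') => [|l]; [apply: (idealD iI)|rewrite mulrnDl; apply: cleD].
  - move=> A B [PA [A' IA' hA]] PB BA; split=> //; exists A' => // l.
    by apply: (cle_trans cP) (hA l); apply: cleMn.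
  - move=> A B PA [PB [B' IB' hB]]; split; first exact: Pmul.
    exists (A *m B') => [|l]; first exact: Imul.
    by rewrite -mulrnAr; apply: cle_mull.
have JI : (J `<=` I)%classic.
  by move=> A [PA [A' IA' /(_ 1)]] h; apply: ideal_down h.
have Jn0 : nonzero J by exists X => //; split=> //; exists Y.
have [U [PU [W IW hW]] hU] := unit_of J lJ JI Jn0.
have [M le] := hU W IW.
have U0 : U = 0.
  apply: (cle_le0 cP) => //; have := cle_trans cP (hW M.+1) le.
  by rewrite mulrSr /cone_le opprD addrA subrr sub0r.
case: Xn0; have [|M' le'] := hU X; first by apply: JI; split=> //; exists Y.
by apply: (cle_le0 cP) => //; move: le'; rewrite U0 mul0rn.
Qed.

End MinimalLeftIdeal.

(** * A nonnegative real form of the algebra *)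

Section RealForm.
Variables (R : comNzRingType) (K : realType) (v : {rmorphism R -> K}) (v_inj : injective v).
Variables (n : nat) (P : set 'M[R]_n) (cP : lgroup_cone P)
  (Pmul : forall A B, P A -> P B -> P (A *m B))
  (Pscale : forall r A, 0 <= v r -> P A -> P (r *: A)) (P1 : P 1%:M) (i0 : 'I_n).
Local Notation "x '⊑' y" := (cone_le P x y) (at level 70).
Local Notation disj := (disjoint_in P).

(** Every matrix is a difference of elements of the cone, and additivity on the
    cone makes the extension to differences well defined. *)
Lemma cone_morphism_extension m (act : 'M[R]_n -> 'M[K]_m) :
  (forall A B, P A -> P B -> act (A + B) = act A + act B) ->
  (forall A B, P A -> P B -> act (A *m B) = act A *m act B) ->
  (forall r A, 0 <= v r -> P A -> act (r *: A) = v r *: act A) ->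
  exists rho : 'M[R]_n -> 'M[K]_m,
  [/\ {morph rho : X Y / X + Y}, forall r X, rho (r *: X) = v r *: rho X,
      forall X Y, rho (X *m Y) = rho X *m rho Y & forall A, P A -> rho A = act A].
Proof.
move=> actD actM actZ; have exd X : exists pq : 'M[R]_n * 'M[R]_n,
    [/\ P pq.1, P pq.2 & X = pq.1 - pq.2].
  by have [p [q [Pp Pq e _]]] := cone_split cP X; exists (p, q).
have [d hd] := choice exd.
pose rho X := act (d X).1 - act (d X).2.
have rhoB A B : P A -> P B -> rho (A - B) = act A - act B.
  move=> PA PB; have := hd (A - B); rewrite /rho; case: (d _) => p q /= [Pp Pq e].
  apply/eqP; rewrite subr_eq addrAC eq_sym subr_eq -!actD //.
  suff -> : A + q = p + B by [].
  by apply/eqP; rewrite -subr_eq addrAC e subrK.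
have dP X : exists p q, [/\ P p, P q & X = p - q].
  by have [Pp Pq e] := hd X; exists (d X).1, (d X).2.
clearbody rho; exists rho; split.
- move=> X Y; have [a [b [Pa Pb ->]]] := dP X; have [c [e [Pc Pe ->]]] := dP Y.
  rewrite addrACA -opprD !rhoB //; try exact: coneD.
  by rewrite !actD // opprD addrACA.
- move=> r X; have [a [b [Pa Pb ->]]] := dP X; rewrite scalerBr rhoB // scalerBr.
  have [r0|/ltW r0] := lerP 0 (v r).
    by rewrite rhoB ?actZ //; exact: Pscale.
  have r0' : 0 <= v (- r) by rewrite rmorphN oppr_ge0.
  have -> : r *: a - r *: b = (- r) *: b - (- r) *: a by rewrite !scaleNr opprK addrC.
  rewrite rhoB; [|exact: Pscale|exact: Pscale].
  by rewrite !actZ // rmorphN !scaleNr opprK addrC.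
- move=> X Y; have [a [b [Pa Pb ->]]] := dP X; have [c [e [Pc Pe ->]]] := dP Y.
  rewrite mulmxBl !mulmxBr opprB addrACA -opprD.
  rewrite !rhoB //; try by apply: coneD => //; apply: Pmul.
  rewrite !actD; try exact: Pmul.
  rewrite !actM // mulmxBl !mulmxBr opprB.
  by rewrite opprD [RHS]addrACA.
- move=> A PA; rewrite -{1}[A]subr0 rhoB //; last exact: cone0.
  suff -> : act 0 = 0 by rewrite subr0.
  apply: (@addrI _ (act 0)); rewrite -actD ?addr0 //; exact: cone0.
Qed.

Section LeftAction.
Variables (I : set 'M[R]_n) (iI : order_ideal P I).
Hypothesis Imul : forall A X, P A -> I X -> I (A *m X).
Hypothesis Imin : forall J, left_ideal P J -> (J `<=` I)%classic ->
  (exists2 X, J X & X <> 0) -> (I `<=` J)%classic.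
Variables (m : nat) (t : 'I_m -> 'M[R]_n) (ft : frame P I t) (m_gt0 : (0 < m)%N).
Variable h : 'I_m -> 'M[R]_n -> K.
Hypotheses (hpa : forall i, positive_additive I (h i))
  (ht : forall i j, h i (t j) = (i == j)%:R)
  (h_functional : forall phi x, positive_additive I phi -> I x ->
    phi x = \sum_j phi (t j) * h j x).

Let It := frame_mem ft.
Let Pt i : P (t i) := ideal_pos iI (It i).

Lemma coord_mono i x y : I y -> P x -> x ⊑ y -> h i x <= h i y.
Proof.
move=> Iy Px xy; have Ix : I x by apply: ideal_down xy.
have Iyx : I (y - x) by apply: (ideal_down iI Iy) => //; apply: cle_subl.
by rewrite -[y](subrK x) (hpa i).1 // lerDr (hpa i).2.
Qed.

Lemma coordMn i x k : I x -> h i (x *+ k) = h i x * k%:R.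
Proof.
move=> Ix; elim: k => [|k IH].
  apply: (@addrI _ (h i 0)); rewrite mulr0 mulr0n -(hpa i).1 ?addr0 //; exact: ideal0 iI.
rewrite mulrS (hpa i).1 ?IH //; last exact: (idealMn iI).
by rewrite -natr1 mulrDr mulr1 addrC.
Qed.

Lemma coord_scale i x r : 0 <= v r -> I x -> I (r *: x) /\ h i (r *: x) = v r * h i x.
Proof.
move=> r0 Ix; have Px := ideal_pos iI Ix.
have lb (s : R) N : N%:R <= v s -> x *+ N ⊑ s *: x.
  move=> le; rewrite /cone_le -scaler_nat -scalerBl; apply: Pscale => //.
  by rewrite rmorphB rmorph_nat subr_ge0.
have ub (s : R) N : v s <= N%:R -> s *: x ⊑ x *+ N.
  move=> le; rewrite /cone_le -scaler_nat -scalerBl; apply: Pscale => //.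
  by rewrite rmorphB rmorph_nat subr_ge0.
have Irx : I (r *: x).
  apply: (ideal_down iI (idealMn iI (Num.truncn (v r)).+1 Ix)); first exact: Pscale.
  by apply: ub; rewrite ltW // truncnS_gt.
split=> //.
(* Scaled by [M.+1], both sides lie in an interval of fixed length [h i x]. *)
suff H M : exists c : K, c <= h i (r *: x) * M.+1%:R <= c + h i x /\
    c <= v r * h i x * M.+1%:R <= c + h i x.
  apply/eqP; rewrite eq_le; apply/andP; split; apply: (@ler_all_natr _ _ _ (h i x)) => M;
  have [c []] := H M; rewrite mulrBl.
    by move=> /andP[_ h1] /andP[h2 _]; rewrite lerBlDr (le_trans h1) // addrC lerD2l.
  by move=> /andP[h1 _] /andP[_ h2]; rewrite lerBlDr (le_trans h2) // addrC lerD2l.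
have rM0 : 0 <= v (r * M.+1%:R) by rewrite rmorphM rmorph_nat mulr_ge0.
pose N := Num.truncn (v (r * M.+1%:R)).
have N1 : N%:R <= v (r * M.+1%:R) by rewrite truncn_le.
have N2 : v (r * M.+1%:R) <= N.+1%:R by rewrite ltW // truncnS_gt.
have rMx : (r *: x) *+ M.+1 = (r * M.+1%:R) *: x.
  by rewrite -scaler_nat scalerA mulrC.
have IrM : I ((r * M.+1%:R) *: x) by rewrite -rMx; apply: (idealMn iI).
exists (h i x * N%:R); rewrite -[X in _ + X]mulr1 -mulrDr natr1.
rewrite -!(coordMn _ _ Ix) -(coordMn _ _ Irx) rMx; split.
  apply/andP; split; apply: coord_mono.
  - exact: IrM.
  - exact: coneMn.
  - exact: lb.
  - exact: (idealMn iI).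
  - exact: (ideal_pos iI IrM).
  - exact: ub.
have -> : v r * h i x * M.+1%:R = h i x * v (r * M.+1%:R).
  by rewrite rmorphM rmorph_nat mulrAC mulrC.
by rewrite !coordMn // !ler_wpM2l // (hpa i).2.
Qed.

Let coord_mull A i x : P A -> I x -> h i (A *m x) = \sum_j h i (A *m t j) * h j x.
Proof.
move=> PA Ix.
apply: (h_functional (phi := fun y => h i (A *m y))) => //.
split=> [y z Iy Iz|y Iy]; last by apply: (hpa i).2; apply: Imul.
by rewrite mulmxDr (hpa i).1 //; apply: Imul.
Qed.

Let coord_mulr i x y : I x -> I y -> h i (y *m x) = \sum_j h i (t j *m x) * h j y.
Proof.
move=> Ix Iy.
apply: (h_functional (phi := fun z => h i (z *m x))) => //.
split=> [z z' Iz Iz'|z Iz]; last by apply: (hpa i).2; apply: Imul => //; apply: ideal_pos Iz.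
by rewrite mulmxDl (hpa i).1 //; apply: Imul => //; apply: (ideal_pos iI).
Qed.

Let act A : 'M[K]_m := \matrix_(i, j) h i (A *m t j).

Lemma act_ge0 A i j : P A -> 0 <= act A i j.
Proof. by move=> PA; rewrite mxE (hpa i).2 //; apply: Imul. Qed.

Lemma actD A B : P A -> P B -> act (A + B) = act A + act B.
Proof.
by move=> PA PB; apply/matrixP => i j; rewrite !mxE mulmxDl (hpa i).1 //; apply: Imul.
Qed.

Lemma actM A B : P A -> P B -> act (A *m B) = act A *m act B.
Proof.
move=> PA PB; apply/matrixP => i j; rewrite !mxE -mulmxA coord_mull //; last exact: Imul.
by apply: eq_bigr => k _; rewrite !mxE.
Qed.

Lemma act1 : act 1%:M = 1%:M.
Proof. by apply/matrixP => i j; rewrite !mxE mul1mx ht. Qed.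

Lemma actZ r A : 0 <= v r -> P A -> act (r *: A) = v r *: act A.
Proof.
move=> r0 PA; apply/matrixP => i j; rewrite !mxE -scalemxAl.
exact: (coord_scale i r0 (Imul PA (It j))).2.
Qed.

(** By minimality, the left ideal generated by [t j] contains every [t i]. *)
Lemma act_positive : exists2 A, P A & forall i j, 0 < act A i j.
Proof.
have exA (ij : 'I_m * 'I_m) : exists A, P A /\ t ij.1 ⊑ A *m t ij.2.
  case: ij => i j /=; pose J : set 'M[R]_n := fun X => P X /\ exists2 A, P A & X ⊑ A *m t j.
  have lJ : left_ideal P J.
    split; first split.
    - by move=> ? [].
    - by split; [exact: cone0|exists 0; [exact: cone0|rewrite mul0mx; exact: cle_refl]].
    - move=> X Y [PX [A PA XA]] [PY [B PB YB]]; split; first exact: coneD.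
      by exists (A + B); [exact: coneD|rewrite mulmxDl; exact: cleD].
    - move=> X Y [PX [A PA XA]] PY YX; split=> //; exists A => //.
      exact: (cle_trans cP) XA.
    - move=> A X PA [PX [B PB XB]]; split; first exact: Pmul.
      by exists (A *m B); [exact: Pmul|rewrite -mulmxA; exact: (cle_mull Pmul)].
  have JI : (J `<=` I)%classic.
    by move=> X [PX [A PA XA]]; apply: (ideal_down iI _ PX XA); apply: Imul.
  have Jn0 : exists2 X, J X & X <> 0.
    exists (t j); last exact: (frame_neq0 ft).
    by split=> //; exists 1%:M => //; rewrite mul1mx; exact: cle_refl.
  by have [_ [A PA XA]] := Imin lJ JI Jn0 (It i); exists A.
have [A hA] := choice exA.
have PS : P (\sum_ij A ij) by apply: cone_sum => // ij _; case: (hA ij).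
exists (\sum_ij A ij) => // i j; rewrite mxE.
have [PA le] := hA (i, j).
apply: lt_le_trans (_ : h i (t i) <= _); first by rewrite ht eqxx ltr01.
apply: coord_mono => //; first exact: Imul.
apply: (cle_trans cP) le _; rewrite /cone_le -mulmxBl; apply: Pmul => //.
by apply: (cle_bigD cP) => k; case: (hA k).
Qed.

(** Left and right multiplications commute, so that right multiplication by an
    element of [I] is scalar in the coordinates of the frame: the product
    [t i *m t l] is a real multiple of [t i], whence the rows of [t i]. *)
Lemma left_ideal_real_form : exists (Q Q' : 'M[K]_n) (s : 'I_n -> 'M[R]_n),
  [/\ Q *m Q' = 1%:M, Q' *m Q = 1%:M,
   forall A, P A -> forall i j, 0 <= (Q *m map_mx v A *m Q') i j &
   forall i, [/\ P (s i), s i <> 0 &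
     forall k l, k != i -> (Q *m map_mx v (s i) *m Q') k l = 0]].
Proof.
have [rho [rhoD rhoZ rhoM rhoE]] := cone_morphism_extension actD actM actZ.
have [S PS S_gt0] := act_positive.
have [z zn0 hz] := perron_commutant m_gt0 S_gt0.
have rho1 : rho 1%:M = 1%:M by rewrite rhoE // act1.
have [|Q [Q' [QQ' Q'Q rhoQ]]] := rep_conjugation i0 rhoD rhoZ rhoM rho1 zn0.
  by move=> Y comm; apply: hz; rewrite -rhoE.
have e : m = n.
  by apply/eqP; rewrite eqn_leq (mulmx1_min QQ') (mulmx1_min Q'Q).
have rmul x : I x -> exists c, forall k j, h k (t j *m x) = c * (k == j)%:R.
  move=> Ix; pose Y : 'M[K]_m := \matrix_(k, j) h k (t j *m x).
  have YA A : P A -> Y *m rho A = rho A *m Y.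
    move=> PA; rewrite rhoE //; apply/matrixP => k j.
    have -> : (act A *m Y) k j = h k (A *m t j *m x).
      rewrite -mulmxA coord_mull //; last exact: Imul.
      by rewrite mxE; apply: eq_bigr => l _; rewrite !mxE.
    rewrite coord_mulr //; last exact: Imul.
    by rewrite mxE; apply: eq_bigr => l _; rewrite !mxE.
  have YX X : Y *m rho X = rho X *m Y.
    have [p [q [Pp Pq -> _]]] := cone_split cP X.
    have -> : p - q = p + (- 1) *: q by rewrite scaleN1r.
    by rewrite rhoD rhoZ mulmxDr mulmxDl -scalemxAr -scalemxAl !YA.
  have [|c ec] := @comm_delta_scalar _ _ (Q' *m Y *m Q) i0.
    move=> i j; have := YX (delta_mx i j); rewrite rhoQ map_delta_mx.
    move=> /(congr1 (fun X => Q' *m X *m Q)).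
    by rewrite !mulmxA Q'Q mul1mx -!mulmxA Q'Q mulmx1.
  exists c => k j; have -> : h k (t j *m x) = Y k j by rewrite mxE.
  have -> : Y = c%:M.
    have -> : Y = Q *m (Q' *m Y *m Q) *m Q' by rewrite !mulmxA QQ' mul1mx -mulmxA QQ' mulmx1.
    by rewrite ec mul_mx_scalar -scalemxAl QQ' scalemx1.
  by rewrite mxE mulr_natr.
have trow i k l : k != i -> (Q *m map_mx v (t i) *m Q') k l = 0.
  move=> ki; rewrite -rhoQ rhoE // mxE; have [c ->] := rmul _ (It l).
  by rewrite (negPf ki) mulr0.
have nonnegQ A : P A -> forall i j, 0 <= (Q *m map_mx v A *m Q') i j.
  by move=> PA i j; rewrite -rhoQ rhoE // act_ge0.
have tn0 := frame_neq0 ft.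
clear - e QQ' Q'Q trow nonnegQ tn0 Pt.
subst m; exists Q, Q', t; by split=> // i; split; [exact: Pt|exact: tn0|exact: trow].
Qed.

End LeftAction.

Lemma real_form : exists (Q Q' : 'M[K]_n) (s : 'I_n -> 'M[R]_n),
  [/\ Q *m Q' = 1%:M, Q' *m Q = 1%:M,
   forall A, P A -> forall i j, 0 <= (Q *m map_mx v A *m Q') i j &
   forall i, [/\ P (s i), s i <> 0 &
     forall k l, k != i -> (Q *m map_mx v (s i) *m Q') k l = 0]].
Proof.
have n_gt0 : (0 < n)%N by case: (n) i0 => // -[].
have [I [[iI Imul] [X IX Xn0] Imin aI]] := minimal_left_ideal_exists v_inj cP Pmul Pscale P1 n_gt0.
have [m [t ft]] := frame_exists cP Pscale v_inj iI (@matrices_dependent _ _ v v_inj n).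
have m_gt0 : (0 < m)%N.
  by case: m t ft => // t ft; case: Xn0; apply: (frame_full ft) => // -[].
have [h [hpa ht h_functional]] := frame_coordinates cP K iI aI ft.
exact: (left_ideal_real_form iI Imul Imin ft m_gt0 hpa ht h_functional).
Qed.

End RealForm.

(** * Positive orthogonal idempotents *)

Lemma map_mx_injective (R : nzRingType) (K : nzRingType) (v : {rmorphism R -> K}) k l :
  injective v -> injective (map_mx v : 'M_(k, l) -> 'M_(k, l)).
Proof.
move=> v_inj A B /matrixP AB; apply/matrixP => i j.
by apply: v_inj; have := AB i j; rewrite !mxE.
Qed.

Section Idempotents.
Variables (R : comNzRingType) (K : realType) (v : {rmorphism R -> K}) (v_inj : injective v).
Variables (n : nat) (P : set 'M[R]_n) (cP : lgroup_cone P)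
  (Pmul : forall A B, P A -> P B -> P (A *m B))
  (Pscale : forall r A, 0 <= v r -> P A -> P (r *: A)) (P1 : P 1%:M).
Local Notation "x '⊑' y" := (cone_le P x y) (at level 70).
Variables (Q Q' : 'M[K]_n) (QQ' : Q *m Q' = 1%:M) (Q'Q : Q' *m Q = 1%:M).
Local Notation conj A := (Q *m map_mx v A *m Q').
Hypothesis conj_ge0 : forall A, P A -> forall i j, 0 <= conj A i j.

Lemma conjM A B : conj (A *m B) = conj A *m conj B.
Proof. by rewrite map_mxM !mulmxA -[_ *m Q' *m Q]mulmxA Q'Q mulmx1. Qed.

Lemma conjB A B : conj (A - B) = conj A - conj B.
Proof. by rewrite map_mxB mulmxBr mulmxBl. Qed.

Lemma conj_le A B i j : A ⊑ B -> conj A i j <= conj B i j.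
Proof. by move/conj_ge0/(_ i j); rewrite conjB mxE [X in _ + X]mxE subr_ge0. Qed.

Lemma conj_inj A B : conj A = conj B -> A = B.
Proof.
move=> /(congr1 (fun X => Q' *m X *m Q)); rewrite !mulmxA Q'Q !mul1mx -!mulmxA Q'Q !mulmx1.
exact: (map_mx_injective v_inj).
Qed.

Lemma one_le_multiple_sqr r : v r != 0 -> exists N, 1%:M ⊑ (r ^+ 2)%:M *+ N.
Proof.
move=> r0; have r2 : 0 < v (r ^+ 2) by rewrite rmorphXn exprn_even_gt0.
exists (Num.truncn (v (r ^+ 2))^-1).+1.
rewrite /cone_le -scaler_nat scale_scalar_mx -raddfB /= -scalemx1; apply: Pscale => //.
rewrite rmorphB rmorph1 rmorphM rmorph_nat subr_ge0 -ler_pdivrMr // mul1r ltW //.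
by rewrite truncnS_gt.
Qed.

(** Columns chosen in the elements [s i] form a matrix whose determinant is
    nonzero, so that a positive multiple of the identity is a combination of the
    [s i]; cutting the identity along it by Riesz decomposition gives [f]. *)
Lemma positive_idempotents (s : 'I_n -> 'M[R]_n) :
  (forall i, [/\ P (s i), s i <> 0 & forall k l, k != i -> conj (s i) k l = 0]) ->
  exists f : 'I_n -> 'M[R]_n, forall i, P (f i) /\ conj (f i) = delta_mx i i.
Proof.
move=> hs.
have exp i : exists p, col p (s i) != 0.
  apply: contrapT => h; case: (hs i) => _ sn0 _; apply: sn0.
  apply/matrixP => k l; rewrite mxE; apply: contrapT => sk; apply: h; exists l.
  by apply/cV0Pn; exists k; rewrite mxE; apply/eqP.
have [p hp] := choice exp.
pose g := \matrix_(k, i) s i k (p i).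
have gE : g = \sum_i s i *m delta_mx (p i) i.
  apply/matrixP => k i; rewrite summxE (bigD1 i) //= big1 => [|j ji].
    rewrite addr0 !mxE (bigD1 (p i)) //= mxE !eqxx mulr1 big1 ?addr0 // => l lp.
    by rewrite mxE (negPf lp) mulr0.
  by rewrite mxE big1 // => l _; rewrite mxE [i == j]eq_sym (negPf ji) andbF mulr0.
pose D := Q *m map_mx v g.
have Dcol i : col i D = Q *m map_mx v (col (p i) (s i)).
  by apply/colP => k; rewrite !mxE; apply: eq_bigr => l _; rewrite !mxE.
have Doff k i : k != i -> D k i = 0.
  move=> ki; have -> : D k i = (conj (s i) *m Q) k (p i).
    rewrite -mulmxA Q'Q mulmx1; have := congr1 (fun x : 'cV_n => x k 0) (Dcol i).
    by rewrite !mxE => ->; apply: eq_bigr => l _; rewrite !mxE.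
  by rewrite mxE big1 // => l _; case: (hs i) => _ _ ->; rewrite ?mul0r.
have Ddiag : D = diag_mx (\row_i D i i).
  apply/matrixP => k i; rewrite [RHS]mxE [X in X *+ _]mxE.
  by case: (k =P i) => [->|/eqP ki]; rewrite ?mulr1n // mulr0n Doff.
have d0 : v (\det g) != 0.
  suff : \det D != 0 by rewrite det_mulmx det_map_mx mulf_eq0 negb_or => /andP[].
  rewrite Ddiag det_diag; apply/prodf_neq0 => i _; rewrite mxE; apply/eqP => Dii.
  have /eqP := hp i; apply; apply: (map_mx_injective v_inj).
  rewrite map_mx0 -[LHS]mul1mx -Q'Q -mulmxA -Dcol.
  suff -> : col i D = 0 by rewrite mulmx0.
  apply/colP => k; rewrite [LHS]mxE [RHS]mxE.
  by have [->|ki] := eqVneq k i; [exact: Dii|exact: Doff].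
pose d := \det g.
(* The extra factor [d] replaces the determinant by its square, which is positive. *)
pose b i := d *: (delta_mx (p i) i *m \adj g).
have sb : \sum_i s i *m b i = (d ^+ 2)%:M.
  under eq_bigr => i _ do rewrite /b -scalemxAr mulmxA.
  by rewrite -scaler_sumr -mulmx_suml -gE mul_mx_adj scale_scalar_mx.
have exb i : exists c, P c /\ b i ⊑ c.
  have [c [e [Pc Pe -> _]]] := cone_split cP (b i).
  by exists c; split=> //; apply: cle_subl.
have [c hc] := choice exb.
have [N leN] := one_le_multiple_sqr d0.
have Psc i : P ((s i *m c i) *+ N).
  by apply: coneMn => //; apply: Pmul; [case: (hs i)|case: (hc i)].
have le1 : 1%:M ⊑ \sum_i (s i *m c i) *+ N.
  apply: (cle_trans cP) leN _; rewrite sumrMnl -/d -sb; apply: cleMn => //.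
  apply: cle_sum => // i _; apply: (cle_mull Pmul); first by case: (hs i).
  by case: (hc i).
have [f [f1 hf]] := riesz_sum cP P1 Psc le1.
exists f => i; split; first by case: (hf i).
have off j k l : k != j -> conj (f j) k l = 0.
  move=> kj; have [Pf fle] := hf j.
  apply/eqP; rewrite eq_le conj_ge0 // andbT; apply: le_trans (conj_le k l fle) _.
  rewrite -mulrnAr conjM mxE big1 // => a _.
  by case: (hs j) => _ _ ->; rewrite ?mul0r.
apply/matrixP => k l; rewrite [RHS]mxE.
have [->|ki] := eqVneq k i; last by rewrite off.
have : \sum_j conj (f j) i l = (1%:M : 'M[K]_n) i l.
  rewrite -summxE -mulmx_suml -mulmx_sumr -map_mx_sum -f1 map_mx1 mulmx1 QQ' //.
rewrite (bigD1 i) //= big1 => [|j ji]; last by rewrite off // eq_sym.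
by rewrite addr0 => ->; rewrite mxE eq_sym.
Qed.

(** The idempotent decomposition makes each corner [f i M f j], which has rank
    one, totally ordered: the two disjoint parts of [w] are multiples of [w], so
    that one of them vanishes. *)
Lemma corner_positive (f : 'I_n -> 'M[R]_n) (a : 'cV[R]_n) (b : 'rV[R]_n) i j :
  (forall i, P (f i) /\ conj (f i) = delta_mx i i) ->
  (exists b', f i = a *m b') -> (exists a', f j = a' *m b) ->
  (exists2 c, 0 < c & conj (a *m b) = c *: delta_mx i j) -> P (a *m b).
Proof.
move=> hf [b' fi] [a' fj] [c c0 cw].
set w := a *m b in cw *.
have fX X : exists r, f i *m X *m f j = r *: w.
  exists ((b' *m X *m a') 0 0); rewrite fi fj /w.
  have -> : a *m b' *m X *m (a' *m b) = a *m (b' *m X *m a') *m b by rewrite !mulmxA.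
  by rewrite {1}[b' *m X *m a']mx11_scalar mul_mx_scalar scalemxAl.
have conjf X : conj (f i *m X *m f j) = delta_mx i i *m conj X *m delta_mx j j.
  by rewrite !conjM (hf i).2 (hf j).2.
have corner (X : 'M[K]_n) k l : (delta_mx i i *m X *m delta_mx j j) k l =
    X k l * ((k == i) && (l == j))%:R.
  rewrite mxE (bigD1 j) //= big1 => [|e ej]; last by rewrite [X in _ * X]mxE (negPf ej) mulr0.
  rewrite mxE (bigD1 i) //= big1 => [|e ei]; last by rewrite mxE (negPf ei) andbF mul0r.
  rewrite !mxE !eqxx !andbT /= !addr0.
  by case: (k =P i) => [->|_]; case: (l =P j) => [->|_]; rewrite /= ?mul1r ?mulr1 ?mul0r ?mulr0.
have fw : f i *m w *m f j = w.
  apply: conj_inj; rewrite conjf cw; apply/matrixP => k l; rewrite corner !mxE.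
  by rewrite -mulrA -natrM mulnb andbb.
have [p [q [Pp Pq e d]]] := cone_split cP w.
have Pf X : P X -> P (f i *m X *m f j).
  by move=> PX; apply: Pmul; [apply: Pmul => //; case: (hf i)|case: (hf j)].
(* An element below its own corner lies in that corner, since its real form does. *)
have part X : P X -> X ⊑ f i *m X *m f j -> exists2 r, 0 <= v r & X = r *: w.
  move=> PX le; have [r er] := fX X.
  have Xr : X = r *: w.
    rewrite -er; apply: conj_inj; rewrite conjf; apply/matrixP => k l; rewrite corner.
    have := conj_le k l le; rewrite conjf corner.
    case: (_ && _); first by rewrite mulr1.
    by rewrite mulr0 => le0; apply/eqP; rewrite eq_le le0 conj_ge0.
  exists r => //; have := conj_ge0 PX i j.
  rewrite Xr map_mxZ -scalemxAr -scalemxAl cw !mxE !eqxx mulr1.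
  by rewrite pmulr_lge0.
have [r r0 pE] : exists2 r, 0 <= v r & p = r *: w.
  apply: part => //; apply: split_le d _ => //; first exact: Pf.
  by rewrite -e -{1}fw e mulmxBr mulmxBl; apply: cle_subl => //; exact: Pf.
have [r' r'0 qE] : exists2 r, 0 <= v r & q = r *: w.
  apply: part => //; apply: (split_le cP Pq Pp) (disjC d) _; first exact: Pf.
  rewrite -[q - p]opprB -e -{1}fw e mulmxBr mulmxBl opprB.
  by apply: cle_subl => //; exact: Pf.
have rr : v r = 1 + v r'.
  have := congr1 (fun X => conj X i j) e; rewrite conjB pE qE !map_mxZ.
  rewrite -!scalemxAr -!scalemxAl cw !mxE !eqxx !mulr1 -mulrBl => /eqP.
  rewrite -subr_eq0 -{1}[c]mul1r -mulrBl mulf_eq0 (gt_eqF c0) orbF subr_eq0.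
  by move=> /eqP ->; rewrite subrK.
have le_mult X t : P X -> 0 <= v t -> t *: X ⊑ X *+ (Num.truncn (v t)).+1.
  move=> PX t0; rewrite /cone_le -scaler_nat -scalerBl; apply: Pscale => //.
  by rewrite rmorphB rmorph_nat subr_ge0 ltW // truncnS_gt.
have s0 : r *: q = 0.
  apply: (disj_self cP); first exact: Pscale.
  apply: disj_le (le_mult q r Pq r0) => //; apply: disjC; apply: disjMn => //.
  have -> : r *: q = r' *: p by rewrite pE qE !scalerA mulrC.
  by apply: disj_le (le_mult p r' Pp r'0) => //; apply: disjC; apply: disjMn => //; exact: disjC.
suff q0 : q = 0 by rewrite e q0 subr0.
apply/matrixP => k l; rewrite mxE; apply: v_inj; rewrite rmorph0.
have := congr1 (fun X : 'M_n => v (X k l)) s0; rewrite !mxE rmorphM rmorph0 => /eqP.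
by rewrite mulf_eq0 rr gt_eqF /= => [/eqP|]; last by rewrite ltr_pwDl.
Qed.

End Idempotents.

(** * Rank-one factorization over a GCD domain *)

Section GCDDomain.
Variables (R : comNzRingType) (gcdR : GCD_domain R).

Lemma domain_mulfI (a b c : R) : a != 0 -> a * b = a * c -> b = c.
Proof.
move=> an0 abc; have /gcdR.1[a0|/eqP] : a * (b - c) = 0 by rewrite mulrBr abc subrr.
  by rewrite a0 eqxx in an0.
by rewrite subr_eq0 => /eqP.
Qed.

(** A gcd whose multiples by [c] are again gcds of the multiples; asked on
    divisors only, this form passes from two elements to a family. *)
Definition scalable_gcd k (x : 'I_k -> R) (d : R) : Prop :=
  (forall i, divides d (x i)) /\
  (forall c e, (forall i, divides e (c * x i)) -> divides e (c * d)).

(** A common divisor [c d] of [c a] and [c b] divides their gcd [g = u c d];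
    then [u d] divides [a] and [b], so that [u] is a unit. *)
Lemma gcd_scalable2 (a b : R) : exists d, [/\ divides d a, divides d b &
  forall c e, divides e (c * a) -> divides e (c * b) -> divides e (c * d)].
Proof.
have div0 (d : R) : divides d 0 by exists 0; rewrite mul0r.
have divx (d : R) : divides d d by exists 1; rewrite mul1r.
have [->|an0] := eqVneq a 0; first by exists b; split.
have [->|bn0] := eqVneq b 0; first by exists a; split.
have [d [da db dmax]] := gcdR.2 a b an0 bn0.
exists d; split=> // c e ea eb.
have [->|cn0] := eqVneq c 0; first by rewrite mul0r.
have prod_neq0 (x y : R) : x != 0 -> y != 0 -> x * y != 0.
  by move=> x0 y0; apply/eqP => /gcdR.1[] xy0; [move: x0|move: y0]; rewrite xy0 eqxx.
have dn0 : d != 0.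
  by apply: contraNneq an0 => d0; case: da => x; rewrite d0 mulr0 => ->.
have [g [ga gb gmax]] := gcdR.2 _ _ (prod_neq0 _ _ cn0 an0) (prod_neq0 _ _ cn0 bn0).
have [u gE] : divides (c * d) g.
  by apply: gmax; [case: da|case: db] => x ->; exists x; rewrite mulrCA.
have div_ud x : divides g (c * x) -> divides (u * d) x.
  move=> [w e1]; exists w; apply: (@domain_mulfI c) => //.
  by rewrite e1 gE [u * (c * d)]mulrCA [RHS]mulrCA.
have [y dE] := dmax _ (div_ud _ ga) (div_ud _ gb).
have [z eg] := gmax _ ea eb.
exists (y * z); rewrite -mulrA -eg gE {1}dE; rewrite [c * (y * _)]mulrCA.
by rewrite [c * (u * d)]mulrCA.
Qed.

Lemma scalable_gcd_exists k (x : 'I_k -> R) : exists d, scalable_gcd x d.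
Proof.
elim: k x => [|k IH] x.
  by exists 0; split=> [[]//|c e _]; exists 0; rewrite mul0r mulr0.
have [d' [dx dmax]] := IH (fun i => x (lift ord0 i)).
have [d [d0 dd' dm]] := gcd_scalable2 (x ord0) d'.
exists d; split=> [i|c e ex].
  case: (unliftP ord0 i) => [j ->|-> //].
  by have [y ->] := dx j; have [w ->] := dd'; exists (y * w); rewrite mulrA.
by apply: dm; [exact: ex|apply: dmax => i; exact: ex].
Qed.

(** The row through a nonzero entry is [d] times a primitive row [c]; the
    other rows are proportional to it, with denominators that divide every entry
    of [c] and hence cancel. *)
Lemma rank_one_factorization m n (X : 'M[R]_(m, n)) : X != 0 ->
  (forall i j k l, X i j * X k l = X i l * X k j) ->
  exists (a : 'cV[R]_m) (b : 'rV[R]_n), X = a *m b.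
Proof.
move=> Xn0 minors.
have [k0 [l0 x0]] : exists k0 l0, X k0 l0 != 0.
  apply: contrapT => h; case/eqP: Xn0; apply/matrixP => i j; rewrite mxE.
  by apply: contrapT => xij; apply: h; exists i, j; apply/eqP.
have [d [dX dmax]] := scalable_gcd_exists (fun l => X k0 l).
have [c hc] := choice dX.
have dn0 : d != 0 by apply: contraNneq x0 => d0; rewrite hc d0 mulr0.
have cn0 : c l0 != 0 by apply: contraNneq x0 => c0; rewrite hc c0 mul0r.
have cross k l : X k l0 * c l = X k l * c l0.
  apply: (@domain_mulfI d) => //; rewrite mulrC [RHS]mulrC.
  by have := minors k l0 k0 l; rewrite !hc !mulrA.
have dv k : divides (c l0) (X k l0).
  have [l|y ey] := dmax (X k l0) (c l0 * d).
    by exists (X k l); rewrite hc !mulrA cross.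
  by exists y; apply: (@domain_mulfI d) => //; rewrite mulrC ey; rewrite mulrA mulrC.
have [al hal] := choice dv.
exists (\col_k al k), (\row_l c l); apply/matrixP => k l.
rewrite mxE big_ord1 !mxE; apply: (@domain_mulfI (c l0)) => //.
by rewrite mulrC -cross hal mulrCA mulrA.
Qed.

End GCDDomain.

(** * Integral matrix units *)

Lemma rank_one_minor (R : comNzRingType) n (u : 'cV[R]_n) (w : 'rV[R]_n) i j k l :
  (u *m w) i j * (u *m w) k l = (u *m w) i l * (u *m w) k j.
Proof. by rewrite !mxE !big_ord1 mulrACA [w 0 j * _]mulrC mulrACA. Qed.

Section Conclusion.
Variables (R : comNzRingType) (K : realType) (v : {rmorphism R -> K}) (v_inj : injective v).
Variables (gcdR : GCD_domain R) (n : nat) (P : set 'M[R]_n) (cP : lgroup_cone P)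
  (Pmul : forall A B, P A -> P B -> P (A *m B))
  (Pscale : forall r A, 0 <= v r -> P A -> P (r *: A)).
Variables (Q Q' : 'M[K]_n) (QQ' : Q *m Q' = 1%:M) (Q'Q : Q' *m Q = 1%:M).
Local Notation conj A := (Q *m map_mx v A *m Q').
Hypothesis conj_ge0 : forall A, P A -> forall i j, 0 <= conj A i j.
Variables (f : 'I_n -> 'M[R]_n) (hf : forall i, P (f i) /\ conj (f i) = delta_mx i i).

(** Conjugation sends [f i] to [delta_mx i i], so its factors [a] and [b] go to
    multiples of the coordinate vectors; changing the sign of both makes the
    scalars positive. *)
Lemma idempotent_factorization i : exists ab : 'cV[R]_n * 'rV[R]_n, f i = ab.1 *m ab.2 /\
  exists c, [/\ 0 < c, Q *m map_mx v ab.1 = c *: delta_mx i 0 &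
    map_mx v ab.2 *m Q' = c^-1 *: delta_mx 0 i].
Proof.
have fv : map_mx v (f i) = (Q' *m delta_mx i (0 : 'I_1)) *m (delta_mx 0 i *m Q).
  rewrite !mulmxA -[Q' *m _ *m delta_mx 0 i]mulmxA mul_delta_mx -(hf i).2.
  by rewrite !mulmxA Q'Q mul1mx -mulmxA Q'Q mulmx1.
have fn0 : f i != 0.
  apply/eqP => f0; have := (hf i).2; rewrite f0 map_mx0 mulmx0 mul0mx.
  move=> /matrixP/(_ i i); rewrite !mxE !eqxx => /eqP.
  by rewrite eq_sym oner_eq0.
have minors j k l m : f i j k * f i l m = f i j m * f i l k.
  apply: v_inj; rewrite !rmorphM.
  have vf a b : v (f i a b) = map_mx v (f i) a b by rewrite mxE.
  by rewrite !vf fv rank_one_minor.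
have [a [b fab]] := rank_one_factorization gcdR fn0 minors.
pose al := Q *m map_mx v a; pose be := map_mx v b *m Q'.
have albe k l : al k 0 * be 0 l = (delta_mx i i : 'M[K]_n) k l.
  rewrite -(hf i).2 fab map_mxM.
  have -> : Q *m (map_mx v a *m map_mx v b) *m Q' = al *m be by rewrite !mulmxA.
  by rewrite [RHS]mxE big_ord1.
have c1 : al i 0 * be 0 i = 1 by rewrite albe mxE !eqxx.
have cn0 : al i 0 != 0.
  by apply/eqP => c0; have /eqP := c1; rewrite c0 mul0r eq_sym oner_eq0.
have bn0 : be 0 i != 0.
  by apply/eqP => c0; have /eqP := c1; rewrite c0 mulr0 eq_sym oner_eq0.
have alE : al = al i 0 *: delta_mx i 0.
  apply/colP => k; rewrite [RHS]mxE [X in _ * X]mxE eqxx andbT.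
  have [->|ki] := eqVneq k i; first by rewrite mulr1.
  by apply: (mulIf bn0); rewrite albe mulr0 mul0r mxE (negPf ki).
have beE : be = (al i 0)^-1 *: delta_mx 0 i.
  apply/rowP => k; rewrite [RHS]mxE [X in _ * X]mxE eqxx /=.
  apply: (mulfI cn0); rewrite albe mulrA mulfV // mul1r mxE eqxx /=.
  by [].
have [c0|c0] := ltP 0 (al i 0).
  by exists (a, b); split=> //; exists (al i 0).
exists (- a, - b); split; first by rewrite fab /= mulNmx mulmxN opprK.
exists (- al i 0); split.
- by rewrite oppr_gt0 lt_def eq_sym cn0.
- by rewrite /= map_mxN mulmxN -/al {1}alE scaleNr.
- by rewrite /= map_mxN mulNmx -/be {1}beE invrN scaleNr.
Qed.

(** In the bases given by the factors of the [f i], the real form becomes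
    integral over [R], and the cone is that of the nonnegative matrices because
    every matrix unit [a i *m b j] is positive. *)
Lemma cone_iso_nonneg : l_algebra_iso P [set A | forall i j, 0 <= v (A i j)]%classic.
Proof.
have [ab hab] := choice idempotent_factorization.
have [c hc] := choice (fun i => (hab i).2).
pose a i := (ab i).1; pose b i := (ab i).2.
have fE i : f i = a i *m b i := (hab i).1.
have c0 i : 0 < c i by case: (hc i).
have aE i : Q *m map_mx v (a i) = c i *: delta_mx i 0 by case: (hc i).
have bE i : map_mx v (b i) *m Q' = (c i)^-1 *: delta_mx 0 i by case: (hc i).
have wE i j : conj (a i *m b j) = (c i / c j) *: delta_mx i j.
  rewrite map_mxM mulmxA -mulmxA aE bE -scalemxAl -scalemxAr scalerA mul_delta_mx //.
have Pw i j : P (a i *m b j).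
  apply: (corner_positive v_inj cP Pmul Pscale Q'Q conj_ge0 (i := i) (j := j) hf).
  - by exists (b i).
  - by exists (a j).
  - by exists (c i / c j); [rewrite divr_gt0|exact: wE].
pose G := \matrix_(k, i) a i k 0; pose H := \matrix_(i, k) b i 0 k.
pose Ga := diag_mx (\row_i c i); pose Gi := diag_mx (\row_i (c i)^-1).
have GaGi : Ga *m Gi = 1%:M.
  rewrite mulmx_diag; apply/matrixP => i j; rewrite !mxE.
  by rewrite mulfV // gt_eqF.
have GiGa : Gi *m Ga = 1%:M by apply: mulmx1C.
have QG : Q *m map_mx v G = Ga.
  apply/matrixP => k i; have := congr1 (fun x : 'cV_n => x k 0) (aE i).
  rewrite !mxE eqxx andbT => e; transitivity (c i * (k == i)%:R).
    by rewrite -e; apply: eq_bigr => l _; rewrite !mxE.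
  by case: eqP => [->|_]; rewrite ?mulr1 ?mulr0 ?mulr1n ?mulr0n.
have HQ : map_mx v H *m Q' = Gi.
  apply/matrixP => i k; have := congr1 (fun x : 'rV_n => x 0 k) (bE i).
  rewrite !mxE eqxx /= => e; transitivity ((c i)^-1 * (k == i)%:R).
    by rewrite -e; apply: eq_bigr => l _; rewrite !mxE.
  by rewrite eq_sym; case: eqP => [->|_]; rewrite ?mulr1 ?mulr0 ?mulr1n ?mulr0n.
have Gv : map_mx v G = Q' *m Ga by rewrite -QG mulmxA Q'Q mul1mx.
have Hv : map_mx v H = Gi *m Q by rewrite -HQ -mulmxA Q'Q mulmx1.
have HG : H *m G = 1%:M.
  apply: (map_mx_injective v_inj); rewrite map_mxM Gv Hv map_mx1.
  by rewrite mulmxA -[_ *m Q *m Q']mulmxA QQ' mulmx1.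
have GH : G *m H = 1%:M by apply: mulmx1C.
have psiE X i j : v ((H *m X *m G) i j) = (c i)^-1 * conj X i j * c j.
  have -> : v ((H *m X *m G) i j) = (Gi *m conj X *m Ga) i j.
    have -> : Gi *m conj X *m Ga = map_mx v (H *m X *m G).
      by rewrite !map_mxM Hv Gv !mulmxA.
    by rewrite [RHS]mxE.
  by rewrite /Ga mul_mx_diag /Gi mul_diag_mx !mxE.
have GE Y : G *m Y *m H = \sum_i \sum_j Y i j *: (a i *m b j).
  rewrite {1}[Y]matrix_sum_delta mulmx_sumr mulmx_suml; apply: eq_bigr => i _.
  rewrite mulmx_sumr mulmx_suml; apply: eq_bigr => j _.
  rewrite -scalemxAr -scalemxAl -(mul_delta_mx (0 : 'I_1)) mulmxA -colE -mulmxA -rowE.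
  congr (_ *: (_ *m _)); first by apply/colP => k; rewrite !mxE.
  by apply/rowP => k; rewrite !mxE.
exists (fun X => H *m X *m G); split.
- by move=> r X Y; rewrite mulmxDr mulmxDl -scalemxAr -scalemxAl.
- split; first by rewrite mulmx1 HG.
  move=> X Y; change (H *m (X *m Y) *m G = H *m X *m G *m (H *m Y *m G)).
  by rewrite !mulmxA -[_ *m G *m H]mulmxA GH mulmx1.
- exists (fun Y => G *m Y *m H) => X.
    by rewrite !mulmxA GH mul1mx -mulmxA GH mulmx1.
  by rewrite !mulmxA HG mul1mx -mulmxA HG mulmx1.
- apply/seteqP; split=> [_ [X PX <-] i j|Y Y0].
    by rewrite psiE !mulr_ge0 ?invr_ge0 ?(ltW (c0 _)) // conj_ge0.
  exists (G *m Y *m H); last by rewrite !mulmxA HG mul1mx -mulmxA HG mulmx1.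
  rewrite GE; apply: cone_sum => // i _; apply: cone_sum => // j _.
  by apply: Pscale; [exact: Y0|exact: Pw].
Qed.

End Conclusion.

Theorem theorem2p4 (K : realType) (S : pred K) (R : GRing.SubComNzRing.type S)
    (gcdR : GCD_domain R) (n : nat) (n_ge2 : (2 <= n)%N)
    (P : set 'M[R]_n) (lP : l_algebra P) (P1 : P 1%:M) :
  l_algebra_iso P (nonneg_mx R n).
Proof.
case: lP => PD Pmul Pscale Pp Pl.
have cP : lgroup_cone P := lattice_lgroup_cone PD Pp Pl.
have v_inj : injective (val : R -> K) := val_inj.
pose i0 : 'I_n := Ordinal (ltnW n_ge2).
have [Q [Q' [s [QQ' Q'Q conj_ge0 hs]]]] := real_form (v := val) v_inj cP Pmul Pscale P1 i0.
have [f hf] := positive_idempotents v_inj cP Pmul Pscale P1 QQ' Q'Q conj_ge0 hs.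
exact: (cone_iso_nonneg v_inj gcdR cP Pmul Pscale QQ' Q'Q conj_ge0 hf).
Qed.
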